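(* Let $G=(V,E,\omega)$ be a finite undirected graph with positive edge weights and let $b:V\to\mathbb{N}_{\ge 1}$. Let $B=\{e_1,\dots,e_k\}$ be a batch of edge updates which is either a batch of insertions ($B\cap E=\emptyset$, $\widetilde{G}=(V,E\cup B)$) or a batch of removals ($B\subseteq E$, $\widetilde{G}=(V,E\setminus B)$). Run \textsc{b-suitor} on $G$, and then run \textsc{Dyn-b-suitor} on the batch $B$ (batch insertion, resp. batch removal), starting from the suitor lists produced by \textsc{b-suitor} on $G$. Let $\widetilde{M}$ be the $b$-matching computed by \textsc{b-suitor} on $\widetilde{G}$. Then, after \textsc{Dyn-b-suitor} is finished, $M^{(f)}=\widetilde{M}$, and $\widetilde{M}$ is a $(1/2)$-approximation of a maximum weight $b$-matching of $\widetilde{G}$.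
   Context: Graphs: $G=(V,E,\omega)$ finite, undirected, $\omega:E\to\mathbb{R}_{>0}$; $N(u)$ is the neighbor set of $u$. Tie-breaking: if $\omega(u,t)=\omega(u,v)$ for edges $\{u,t\},\{u,v\}$, one declares $\omega(u,t)>\omega(u,v)$ iff $t<v$ (vertices carry totally ordered IDs); all weight comparisons and argmax's use this order. A $b$-matching is $M\subseteq E$ with every vertex $u$ incident to at most $b(u)$ edges of $M$; its weight is $\omega(M)=\sum_{e\in M}\omega(e)$; a maximum weight $b$-matching (MWBM) has maximum weight; a $(1/2)$-approximation is a $b$-matching of weight at least half the maximum. Suitor lists: each vertex $u$ has a set $S(u)\subseteq V$ with $|S(u)|\le b(u)$; $u$ is saturated if $|S(u)|=b(u)$, unsaturated otherwise. $S(u).min$ is None if $u$ is unsaturated, and otherwise the $x\in S(u)$ minimizing $\omega(u,x)$. Convention: $\omega(u,\text{None})$ is smaller than every edge weight. $S(u).insert(x)$: if $u$ is unsaturated, add $x$ and return None; otherwise remove $m=S(u).min$, add $x$, and return $m$. $S(u).remove(x)$ deletes $x$. \textsc{b-suitor} on a graph $H$: set $S(v)=\emptyset$ for all $v$; let $Q$ be a queue containing $b(v)$ copies of each vertex $v$. While $Q\neq\emptyset$: pop $u$; let $p=\operatorname{argmax}_{v\in N(u)\setminus S(u)}\{\omega(u,v):\omega(u,v)>\omega(v,S(v).min)\}$ (None if no such $v$); if $p\neq$ None, let $y=S(p).insert(u)$ and if $y\ne$ None push $y$ into $Q$. Output $M=\{\{u,v\}\in E(H): v\in S(u)\wedge u\in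 S(v)\}$. \textsc{Dyn-b-suitor}: starting from the lists $S$ produced by \textsc{b-suitor} on $G$, it maintains intermediate lists $S^{(i)}$ (initially $S^{(i)}=S$) on the current updated graph with neighborhoods $\widetilde{N}(\cdot)$; $M^{(i)}=\{\{u,v\}\in\widetilde{E}: v\in S^{(i)}(u)\wedge u\in S^{(i)}(v)\}$, and after termination the lists are $S^{(f)}$ and $M^{(f)}$ is the corresponding set. FindAffected$(x)$: $cu\gets x$, $looseEnd\gets$ None. Loop: $ca\gets\operatorname{argmax}_{v\in\widetilde{N}(cu)\setminus S^{(i)}(cu)}\{\omega(cu,v):\omega(cu,v)>\omega(v,S^{(i)}(v).min)\}$ (None if none); if $ca=$ None, exit loop. Otherwise $prevCu\gets S^{(i)}(cu).insert(ca)$, $prevCa\gets S^{(i)}(ca).insert(cu)$; if $prevCu\ne$ None, do $S^{(i)}(prevCu).remove(cu)$ and $looseEnd\gets prevCu$; if $prevCa\neq$ None, do $S^{(i)}(prevCa).remove(ca)$, $cu\gets prevCa$ and repeat the loop, otherwise exit the loop. After the loop, if $looseEnd\neq$ None call FindAffected$(looseEnd)$. EdgeInsertion$(\{u,v\})$ (the edge already added to the current graph): if $\omega(u,v)>\max\{\omega(u,S^{(i)}(u).min),\omega(v,S^{(i)}(v).min)\}$: $startU\gets S^{(i)}(u).insert(v)$, $startV\gets S^{(i)}(v).insert(u)$; if $startU\ne$ None, do $S^{(i)}(startU).remove(u)$ and FindAffected$(startU)$; if $startV\neq$ None, do $S^{(i)}(startV).remove(v)$ and FindAffected$(startV)$.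 EdgeRemoval$(\{u,v\})$ (the edge already removed from the current graph): if $u\in S^{(i)}(v)$ and $v\in S^{(i)}(u)$: remove $v$ from $S^{(i)}(u)$ and $u$ from $S^{(i)}(v)$, then call FindAffected$(u)$ and FindAffected$(v)$. Batch insertion/removal: process the edges of $B$ one after another, each time adding (resp. removing) the edge from the current edge set and calling EdgeInsertion (resp. EdgeRemoval), carrying over the suitor lists; at the end $M^{(f)}$ is computed from the final lists.
   Formalization: Two lines of pseudocode are corrected, as the claim fails for them: b-suitor's argmax excludes vertices v with u in S(v) instead of v in S(u), and EdgeInsertion removes u from S(startU) and v from S(startV) before either call of FindAffected. *)

(* Defs.v *)
From mathcomp Require Import all_boot all_order all_algebra.

Set Implicit Arguments.
Unset Strict Implicit.
Unset Printing Implicit Defensive.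

Import Order.TTheory GRing.Theory Num.Theory.

(* Vertices form a finite totally ordered type: the order is that of the IDs.
   A graph on V is given by its edge set, a set of two-element sets. *)

Section Graphs.

Context {d : Order.disp_t} {V : finOrderType d} {R : realFieldType}.
Variables (w : {set V} -> R) (b : V -> nat).
Implicit Types (E M : {set {set V}}) (u v t x y : V).

Definition simple_graph E : Prop := forall e, e \in E -> #|e| = 2.

Definition neighbors E u : {set V} := [set v | [set u; v] \in E].

Definition weight M : R := (\sum_(e in M) w e)%R.

Definition bmatching E M : Prop :=
  M \subset E /\ forall u, #|[set e in M | u \in e]| <= b u.

Definition max_weight_bmatching E M : Prop :=
  bmatching E M /\ forall M', bmatching E M' -> (weight M' <= weight M)%R.

Definition half_approximation E M : Prop :=
  bmatching E M /\
  forall Mopt, max_weight_bmatching E Mopt -> (weight Mopt / 2%:R <= weight M)%R.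

(* w(u,t) > w(u,v) for two edges with common endpoint u, ties resolved in
   favour of the smaller ID. *)
Definition heavier u t v : bool :=
  (w [set u; v] < w [set u; t])%R ||
  ((w [set u; t] == w [set u; v]) && (t < v)%O).

(* w(u,t) > w(u,o), where w(u,None) is below all edge weights. *)
Definition heavier_opt u t (o : option V) : bool :=
  if o is Some v then heavier u t v else true.

Definition argmax u (C : {set V}) : option V :=
  [pick v in C | [forall t in C, (t != v) ==> heavier u v t]].

Definition lists := {ffun V -> {set V}}.
Implicit Types S : lists.

Definition empty_lists : lists := [ffun=> set0].

Definition saturated S u : bool := #|S u| == b u.

Definition lmin S u : option V :=
  if saturated S u
  then [pick x in S u | [forall y in S u, (y != x) ==> heavier u y x]]
  else None.

Definition set_list S u (A : {set V}) : lists :=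
  [ffun v => if v == u then A else S v].

Definition insert S u x : option V * lists :=
  if lmin S u is Some m
  then (Some m, set_list S u (x |: (S u :\ m)))
  else (None, set_list S u (x |: S u)).

Definition remove S u x : lists := set_list S u (S u :\ x).

(* S(o).remove(x), skipped when o is None. *)
Definition remove_opt S (o : option V) x : lists :=
  if o is Some u then remove S u x else S.

Definition matching_of E S : {set {set V}} :=
  [set [set p.1; p.2] | p : V * V &
    [&& [set p.1; p.2] \in E, p.2 \in S p.1 & p.1 \in S p.2]].

(* w(u,v) > w(v, S(v).min) *)
Definition accepts S v u : bool := heavier_opt v u (lmin S v).

(* In the static algorithm lists are one-sided: u \in S(v) means that u's
   proposal to v stands, and v need not be in S(u).  The excluded vertices are
   those already holding a proposal of u.  This corrects pseudocode taking the
   argmax over N(u) \ S(u) for the same S: excluding the members of u's own list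
   would forbid u to answer a proposal, so that on a single edge with b = 1 the
   output would be empty. *)
Definition proposal E S u : option V :=
  argmax u [set v in neighbors E u | (u \notin S v) && accepts S v u].

Definition bsuitor_step E u (Q : seq V) S : seq V * lists :=
  if proposal E S u is Some p then
    let: (y, S') := insert S p u in
    (if y is Some z then rcons Q z else Q, S')
  else (Q, S).

Inductive bsuitor_loop E : seq V -> lists -> lists -> Prop :=
| BSuitorDone S : bsuitor_loop E [::] S S
| BSuitorStep u Q S Sf :
    bsuitor_loop E (bsuitor_step E u Q S).1 (bsuitor_step E u Q S).2 Sf ->
    bsuitor_loop E (u :: Q) S Sf.

(* The order in which the b(v) copies of each v are enqueued is arbitrary. *)
Definition initial_queue (Q : seq V) : Prop := forall v, count_mem v Q = b v.

(* b-suitor on (V, E), started with queue Q, terminates with lists S. *)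
Definition bsuitor E (Q : seq V) S : Prop := bsuitor_loop E Q empty_lists S.

(* In the dynamic algorithm matched vertices are inserted on both sides. *)
Definition partner E S cu : option V :=
  argmax cu [set v in neighbors E cu :\: S cu | accepts S v cu].

(* One pass of the loop of FindAffected once ca is found; returns prevCa, the
   updated looseEnd and the updated lists. *)
Definition affected_step S cu ca (loose : option V) :
    option V * option V * lists :=
  let: (prevCu, S1) := insert S cu ca in
  let: (prevCa, S2) := insert S1 ca cu in
  let S3 := remove_opt S2 prevCu cu in
  let S4 := remove_opt S3 prevCa ca in
  (prevCa, if prevCu is Some y then Some y else loose, S4).

(* affected_loop E S cu l S' l': from lists S, current vertex cu and
   looseEnd = l, the loop exits with lists S' and looseEnd = l'. *)
Inductive affected_loop E :
    lists -> V -> option V -> lists -> option V -> Prop :=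
| AffectedNone S cu l :
    partner E S cu = None -> affected_loop E S cu l S l
| AffectedExit S cu l ca l' S' :
    partner E S cu = Some ca ->
    affected_step S cu ca l = (None, l', S') ->
    affected_loop E S cu l S' l'
| AffectedNext S cu l ca x l' S' lf Sf :
    partner E S cu = Some ca ->
    affected_step S cu ca l = (Some x, l', S') ->
    affected_loop E S' x l' Sf lf ->
    affected_loop E S cu l Sf lf.

Inductive find_affected E : lists -> V -> lists -> Prop :=
| FindAffectedEnd S x S' :
    affected_loop E S x None S' None -> find_affected E S x S'
| FindAffectedLoose S x S' y Sf :
    affected_loop E S x None S' (Some y) ->
    find_affected E S' y Sf -> find_affected E S x Sf.

Definition find_affected_opt E S (o : option V) S' : Prop :=
  if o is Some x then find_affected E S x S' else S' = S.

(* E is the current edge set, already containing {u,v}.  w(u,v) exceeds the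
   maximum of two weights iff it exceeds both; each comparison is then between
   edges with a common endpoint, where the tie-breaking rule applies.

   Both displaced vertices are detached before either is repaired, as in
   edge_removal.  This deviates from pseudocode running
   S(startU).remove(u); FindAffected(startU) before S(startV).remove(v): there
   FindAffected(startU) sees a stale occurrence of v in S(startV) and may end
   with asymmetric lists and a lost edge.  Example: vertices 0..4,
   b = (2,1,1,2,1), weights 14:8, 03:1, 02:3, 04:5, 24:6, 13:2, inserting
   {u,v} = {1,0} of weight 9 loses the edge 03. *)
Definition edge_insertion E u v S Sf : Prop :=
  if heavier_opt u v (lmin S u) && heavier_opt v u (lmin S v) then
    let: (startU, S1) := insert S u v in
    let: (startV, S2) := insert S1 v u in
    let S3 := remove_opt S2 startU u in
    let S4 := remove_opt S3 startV v in
    exists2 S5, find_affected_opt E S4 startU S5 &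
                find_affected_opt E S5 startV Sf
  else Sf = S.

(* E is the current edge set, from which {u,v} has already been removed. *)
Definition edge_removal E u v S Sf : Prop :=
  if (u \in S v) && (v \in S u) then
    let S1 := remove S u v in
    let S2 := remove S1 v u in
    exists2 S3, find_affected E S2 u S3 & find_affected E S3 v Sf
  else Sf = S.

Inductive batch_kind := Insertions | Removals.

(* A batch lists its edges in processing order, each with the orientation (u,v)
   under which it is passed to the update procedure. *)
Definition batch_edges (B : seq (V * V)) : seq {set V} :=
  [seq [set p.1; p.2] | p <- B].

Definition valid_batch (k : batch_kind) E (B : seq (V * V)) : Prop :=
  uniq (batch_edges B) /\
  match k with
  | Insertions => [disjoint [set:: batch_edges B] & E]
  | Removals => [set:: batch_edges B] \subset E
  end.

Definition update_edges (k : batch_kind) E (A : {set {set V}}) :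
    {set {set V}} :=
  match k with Insertions => E :|: A | Removals => E :\: A end.

Definition updated_graph (k : batch_kind) E (B : seq (V * V)) :
    {set {set V}} :=
  update_edges k E [set:: batch_edges B].

Definition edge_update (k : batch_kind) :=
  match k with Insertions => edge_insertion | Removals => edge_removal end.

(* dyn_bsuitor k E B S Sf: with current edge set E and lists S, processing the
   updates B one after another terminates with lists Sf. *)
Inductive dyn_bsuitor (k : batch_kind) :
    {set {set V}} -> seq (V * V) -> lists -> lists -> Prop :=
| DynDone E S : dyn_bsuitor k E [::] S S
| DynStep E u v B S S' Sf :
    edge_update k (update_edges k E [set [set u; v]]) u v S S' ->
    dyn_bsuitor k (update_edges k E [set [set u; v]]) B S' Sf ->
    dyn_bsuitor k E ((u, v) :: B) S Sf.

End Graphs.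

(* Main.v *)
Require Import Defs.
From mathcomp Require Import all_boot all_order all_algebra.
From mathcomp Require Import zify.

(* The local preferences, ties included, are induced by one global ranking of the
   edges.  Hence for every graph there is exactly one family of symmetric lists
   without blocking edge (an edge outside the lists that both endpoints would
   accept): two such families agree, by induction from the heaviest edge
   downwards.  Both b-suitor and Dyn-b-suitor end in this family, and charging
   every edge of an arbitrary b-matching that is missing from it to a saturated
   endpoint gives the factor 1/2.

   For the dynamic algorithm, a state is described by the vertices that may have
   a vacant slot: the current vertex cu and the loose end.  Blocking edges are
   never accepted by both endpoints once these slots are discounted, so that when
   no vacancy is left the lists are stable.  A step that improves the list of cu
   is a progress for the weight 5^rank.  The delicate case is a call on a vertex
   saturated in the meantime, which may replace its lightest partner m by a still
   lighter one.  This happens only when the lists S0 are already stable; the call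
   then retrieves the lost edge, and a further step of this kind can only concern
   an edge of smaller rank, whence termination. *)

Set Implicit Arguments.
Unset Strict Implicit.
Unset Printing Implicit Defensive.

Import Order.TTheory GRing.Theory Num.Theory.

Section BSuitor.
Context {d : Order.disp_t} {V : finOrderType d} {R : realFieldType}.
Context (w : {set V} -> R) (b : V -> nat).
Hypothesis b_gt0 : forall v, 1 <= b v.
Implicit Types (E : {set {set V}}) (u v s t x y z : V) (p q : V * V) (A : {set V}).
Implicit Types (S : @lists d V) (o : option V).

Local Notation lmin := (lmin w b).
Local Notation accepts := (accepts w b).
Local Notation partner := (partner w b).

(** * Edge ranks *)

Definition vertex_rank x : nat := #|[set y : V | (y < x)%O]|.

Lemma vertex_rank_lt x y : (vertex_rank x < vertex_rank y) = (x < y)%O.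
Proof.
have mono a c : (a < c)%O -> vertex_rank a < vertex_rank c.
  move=> ac; apply: proper_card; apply/properP; split.
    by apply/subsetP=> z; rewrite !inE => /lt_trans; apply.
  by exists a; rewrite !inE ?ltxx.
case: (ltgtP x y) => [/mono//|/mono|->]; last by rewrite ltnn.
by move=> /ltnW; rewrite leqNgt => /negbTE.
Qed.

(* The local tie-breaking rule is induced by a global order on edges: among
   edges of equal weight sharing an endpoint, the smaller ID is the smaller sum
   of vertex ranks.  The last component only makes the order strict. *)
Definition edge_lt p q : bool :=
  let wp := w [set p.1; p.2] in let wq := w [set q.1; q.2] in
  let sp := vertex_rank p.1 + vertex_rank p.2 in
  let sq := vertex_rank q.1 + vertex_rank q.2 in
  (wp < wq)%R || (wp == wq) && ((sq < sp) || (sq == sp) &&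
     (enum_rank [set p.1; p.2] < enum_rank [set q.1; q.2])).

(** All pairs of vertices are ranked, edges or not, so that one ranking serves every graph of the
    batch. *)
Definition rk u v : nat := #|[set p : V * V | edge_lt p (u, v)]|.

Lemma edge_ltxx p : edge_lt p p = false.
Proof. by rewrite /edge_lt ltxx !ltnn !andbF. Qed.

Lemma edge_lt_trans : transitive edge_lt.
Proof.
move=> q p r; rewrite /edge_lt.
set wp := w [set p.1; _]; set wq := w [set q.1; _]; set wr := w [set r.1; _].
case: (ltgtP wp wq) => //= pq; case: (ltgtP wq wr) => //= qr.
- by rewrite (lt_trans pq qr).
- by rewrite -qr pq.
- by rewrite pq qr.
rewrite pq qr ltxx eqxx /=; lia.
Qed.

Lemma edge_lt_total p q : [set p.1; p.2] != [set q.1; q.2] ->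
  edge_lt p q || edge_lt q p.
Proof.
rewrite /edge_lt => pq.
case: (ltgtP (w [set p.1; p.2]) (w [set q.1; q.2])) => //= _.
have: (enum_rank [set p.1; p.2] != enum_rank [set q.1; q.2] :> nat).
  by apply: contra pq => /eqP /ord_inj /enum_rank_inj ->.
rewrite neq_ltn; move: (_ + _) (_ + _) (nat_of_ord _) (nat_of_ord _) => a c e f.
by case: (ltngtP a c) => //= _; rewrite ?orbT //; case: (ltngtP e f).
Qed.

Lemma edge_lt_rk p q : edge_lt p q -> rk p.1 p.2 < rk q.1 q.2.
Proof.
case: p q => [a c] [e f] /= pq; apply: proper_card; apply/properP; split.
  by apply/subsetP=> z; rewrite !inE => /edge_lt_trans; apply.
by exists (a, c); rewrite !inE ?edge_ltxx.
Qed.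

Lemma rkC u v : rk u v = rk v u.
Proof.
by apply: eq_card => p; rewrite !inE /edge_lt /= (setUC [set u]) (addnC (vertex_rank u)).
Qed.

Lemma rk_inj u v x y : rk u v = rk x y -> [set u; v] = [set x; y].
Proof.
move=> e; apply/eqP/negPn/negP => /(@edge_lt_total (u, v) (x, y)).
by move=> /orP[] /edge_lt_rk /=; rewrite e ltnn.
Qed.

Lemma set2_injr u x y : [set u; x] = [set u; y] -> x = y.
Proof.
move=> e; have: x \in [set u; y] by rewrite -e set22.
rewrite !inE => /orP[/eqP xu|/eqP//].
have: y \in [set u; x] by rewrite e set22.
by rewrite xu !inE orbb => /eqP.
Qed.

(** At the common endpoint the rank of [u] cancels in the two sums, which leaves the comparison of
    IDs. The converse holds since for [t != v] one direction of [heavier] is always true. *)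
Lemma heavierE u t v : heavier w u t v = (rk u v < rk u t).
Proof.
have [->|tv] := eqVneq t v.
  by rewrite /heavier ltnn !ltxx andbF.
have h x y : x != y -> heavier w u x y -> rk u y < rk u x.
  move=> xy hv; apply: (@edge_lt_rk (u, y) (u, x)).
  move: hv; rewrite /heavier /edge_lt /= ltn_add2l vertex_rank_lt eqn_add2l.
  case/orP=> [->//|/andP[/eqP-> ->]].
  by rewrite ltxx eqxx.
have [/h->//|nh] := boolP (heavier w u t v).
suff /h : heavier w u v t.
  by rewrite eq_sym tv => /(_ isT); lia.
move: nh; rewrite /heavier.
case: (ltgtP (w [set u; v]) (w [set u; t])) => //= _.
by rewrite -leNgt le_eqVlt eq_sym (negbTE tv).
Qed.

Lemma rk_injr u x y : rk u x = rk u y -> x = y.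
Proof. by move/rk_inj/set2_injr. Qed.

Lemma rk_ind (P : V -> V -> Prop) :
  (forall u v, (forall x y, rk u v < rk x y -> P x y) -> P u v) ->
  forall u v, P u v.
Proof.
move=> ih u v; have [n] := ubnP (#|{: V * V}| - rk u v).
elim: n u v => // n IHn u v lt_n; apply: ih => x y lt_xy; apply: IHn.
have le_rk s t : rk s t <= #|{: V * V}| by apply: max_card.
have := le_rk x y; lia.
Qed.

(** * Lists *)

(** Comparing this count with [b u] expresses acceptance uniformly for saturated and unsaturated
    vertices. *)
Definition cnt A u t : nat := #|[set x in A | rk u t < rk u x]|.

Lemma cnt_le A u t : cnt A u t <= #|A|.
Proof. by apply: subset_leq_card; apply/subsetP=> x; rewrite inE => /andP[]. Qed.

Lemma cnt_all A u t : (forall x, x \in A -> rk u t < rk u x) -> cnt A u t = #|A|.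
Proof.
by move=> h; apply: eq_card => x; rewrite inE andb_idr // => /h.
Qed.

Lemma cnt_lt A u t x : x \in A -> rk u x <= rk u t -> cnt A u t < #|A|.
Proof.
move=> xA le_xt; apply: proper_card; apply/properP; split.
  by apply/subsetP=> y; rewrite inE => /andP[].
by exists x; rewrite // inE xA ltnNge le_xt.
Qed.

Lemma cntD1 A u t x : cnt A u t <= cnt (A :\ x) u t + (x \in A).
Proof.
rewrite /cnt (cardsD1 x) inE addnC leq_add //; last by case: (x \in A) => //=; case: ltnP.
by apply: subset_leq_card; apply/subsetP=> y; rewrite !inE => /and3P[-> -> ->].
Qed.

Lemma cntD1_eq A u t x : rk u x <= rk u t -> cnt (A :\ x) u t = cnt A u t.
Proof.
move=> le_xt; apply: eq_card => y; rewrite !inE.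
have [->|yx] //= := eqVneq y x.
by rewrite ltnNge le_xt andbF.
Qed.

Lemma cntU1 A u t x : x \notin A -> cnt (x |: A) u t = (rk u t < rk u x) + cnt A u t.
Proof.
move=> xA; rewrite /cnt (cardsD1 x) !inE eqxx /=; congr (_ + _).
apply: eq_card => y; rewrite !inE; have [->|yx] //= := eqVneq y x.
by rewrite (negbTE xA).
Qed.

Lemma cnt_geP A u t n : n <= cnt A u t -> #|A| <= n ->
  forall x, x \in A -> rk u t < rk u x.
Proof.
move=> h1 h2 x xA; rewrite ltnNge; apply/negP => /(cnt_lt xA).
by rewrite ltnNge (leq_trans h2).
Qed.

Lemma argmax_Some u A v : argmax w u A = Some v ->
  v \in A /\ forall t, t \in A -> t != v -> rk u t < rk u v.
Proof.
rewrite /argmax; case: pickP => // x /andP[xA /forallP h] [<-]; split=> // t tA tx.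
by move: (h t); rewrite tA tx /= heavierE.
Qed.

Lemma argmax_None u A : argmax w u A = None -> A = set0.
Proof.
rewrite /argmax; case: pickP => // h _; apply/eqP; rewrite -subset0.
apply/subsetP => a aA; case: (arg_maxnP (rk u) aA) => x /(id : _ -> is_true (x \in A)) xA xmax.
move: (h x); rewrite xA /= => /negP[]; apply/forallP=> t; apply/implyP=> tA.
apply/implyP=> tx; rewrite heavierE ltn_neqAle; move: (xmax t tA) => /= ->.
by rewrite andbT; apply: contra tx => /eqP/rk_injr ->.
Qed.

Variant lmin_spec S u : option V -> Prop :=
| LminNone of #|S u| < b u : lmin_spec S u None
| LminSome m of #|S u| = b u & m \in S u
    & (forall y, y \in S u -> y != m -> rk u m < rk u y) : lmin_spec S u (Some m).

Lemma lminP S u : #|S u| <= b u -> lmin_spec S u (lmin S u).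
Proof.
rewrite /Defs.lmin /saturated; case: eqP => [eb _|]; last first.
  by move/eqP=> nb le; constructor; rewrite ltn_neqAle nb.
case: pickP => [m /andP[mS /forallP h]|h].
  constructor=> // y yS ym.
  by move: (h y); rewrite yS ym /= heavierE.
have /card_gt0P[a aS]: 0 < #|S u| by rewrite eb b_gt0.
case: (arg_minnP (rk u) aS) => x /(id : _ -> is_true (x \in S u)) xS xmin; exfalso.
move: (h x); rewrite xS /= => /negP[]; apply/forallP=> t; apply/implyP=> tS.
apply/implyP=> tx; rewrite heavierE ltn_neqAle; move: (xmin t tS) => /= ->.
by rewrite andbT; apply: contra tx => /eqP/rk_injr ->.
Qed.

Lemma lmin_in S u m : #|S u| <= b u -> lmin S u = Some m -> m \in S u.
Proof. by move=> le; case: (lminP le) => // x _ xS _ [<-]. Qed.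

(** A saturated [v] reaches the count [b v] exactly when even its lightest partner beats [u]; as [u]
    is not in the list, injectivity of the rank excludes equality. *)
Lemma acceptsE S v u : #|S v| <= b v -> u \notin S v ->
  accepts S v u = (cnt (S v) v u < b v).
Proof.
move=> le uS; rewrite /Defs.accepts; case: (lminP le) => [lt|m eb mS mmin] /=.
  by rewrite (leq_ltn_trans (cnt_le _ _ _) lt).
rewrite heavierE; case: ltnP => h; apply/esym.
  by rewrite -eb (cnt_lt mS) // ltnW.
apply/negbTE; rewrite -leqNgt -eb cnt_all // => x xS.
have [->|xm] := eqVneq x m; last by rewrite (leq_ltn_trans h) ?mmin.
rewrite ltn_neqAle h andbT; apply: contra uS => /eqP/rk_injr ->.
exact: mS.
Qed.

Definition del o A := if o is Some m then A :\ m else A.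

Definition put S u x : {set V} := x |: del (lmin S u) (S u).

Lemma insertE S u x : insert w b S u x = (lmin S u, set_list S u (put S u x)).
Proof. by rewrite /insert /put; case: lmin. Qed.

Lemma del_sub o A : del o A \subset A.
Proof. by case: o => //= m; apply: subsetDl. Qed.

(** * Replacing the lightest entry of a list *)

Section Put.
Variables (S : @lists d V) (u x : V).
Hypotheses (le_b : #|S u| <= b u) (xS : x \notin S u).

Let x_del : x \notin del (lmin S u) (S u).
Proof. by apply: contra xS; apply: (subsetP (del_sub _ _)). Qed.

Lemma card_put : #|put S u x| = minn (b u) #|S u|.+1.
Proof.
rewrite /put cardsU1 x_del; case: (lminP le_b) => [lt|m eb mS _] /=.
  by rewrite add1n (minn_idPr lt).
by have := cardsD1 m (S u); rewrite mS eb => <-; rewrite (minn_idPl (leqnSn _)).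
Qed.

Lemma put_full t : lmin S u != None ->
  (forall y, y \in put S u x -> rk u t < rk u y) -> cnt (put S u x) u t = b u.
Proof.
move=> h /cnt_all ->; rewrite card_put; move: h.
case: (lminP le_b) => // m; lia.
Qed.

(** Accepting a better entry only raises the threshold. The release of [m] could matter only for [t]
    not heavier than [m], and for such [t] the new list is full of heavier entries. *)
Lemma cnt_put t : cnt (S u) u x < b u -> cnt (put S u x) u t < b u ->
  cnt (S u) u t + (rk u t < rk u x) <= cnt (put S u x) u t /\ lmin S u != Some t.
Proof.
move=> acc; rewrite /put cntU1 ?x_del //; case: (lminP le_b) => [lt|m eb mS mmin] /=.
  by split=> //; rewrite addnC.
have lt_mx : rk u m < rk u x.
  rewrite ltnNge; apply: contraL acc => le; rewrite -leqNgt -eb cnt_all // => y yS.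
  have [ym|ym] := eqVneq y m; last by apply: leq_ltn_trans le (mmin _ yS ym).
  rewrite ltn_neqAle ym le andbT; apply: contra xS => /eqP/rk_injr ->.
  exact: mS.
have [le_tm|lt_mt] := leqP (rk u t) (rk u m); last first.
  rewrite cntD1_eq ?(ltnW lt_mt) // addnC => _; split=> //.
  by apply/eqP=> -[e]; rewrite e ltnn in lt_mt.
rewrite (leq_ltn_trans le_tm lt_mx) cnt_all.
  by have := cardsD1 m (S u); rewrite mS; lia.
by move=> y; rewrite !inE => /andP[ym yS]; apply: leq_ltn_trans le_tm (mmin _ yS ym).
Qed.

Lemma acc_put t : cnt (S u) u x < b u -> t \notin put S u x -> cnt (put S u x) u t < b u ->
  t \notin S u /\ cnt (S u) u t < b u.
Proof.
move=> acc tp lt; have [le ne] := cnt_put acc lt; split; last first.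
  by apply: leq_ltn_trans lt; apply: leq_trans le; apply: leq_addr.
apply: contra tp; rewrite /put inE => tS; apply/orP; right.
case: lmin ne => //= m ne; rewrite !inE tS andbT.
by apply: contra ne => /eqP->.
Qed.

(** Here [x] enters below all entries of a full list, so it becomes the lightest entry and sets the
    new threshold. *)
Lemma cnt_put_bad t : b u <= cnt (S u) u x -> cnt (put S u x) u t < b u ->
  rk u x <= rk u t.
Proof.
move=> nacc; rewrite ltnNge => h; rewrite leqNgt; apply: contra h => lt_tx.
have xmin := cnt_geP nacc le_b.
rewrite (@put_full t) //.
  case: (lminP le_b) => // lt.
  by have := leq_trans nacc (cnt_le _ _ _); rewrite leqNgt lt.
move=> y; rewrite !inE => /orP[/eqP->//|/(subsetP (del_sub _ _)) /xmin].
exact: ltn_trans.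
Qed.

Lemma lmin_lt m : lmin S u = Some m -> cnt (S u) u x < b u -> rk u m < rk u x.
Proof.
case: (lminP le_b) => // y eb yS ymin [<-{m}] acc.
rewrite ltnNge; apply: contraL acc => le; rewrite -leqNgt -eb cnt_all // => m mS.
have [my|my] := eqVneq m y; last by apply: leq_ltn_trans le (ymin _ mS my).
rewrite ltn_neqAle my le andbT; apply: contra xS => /eqP/rk_injr ->.
exact: yS.
Qed.

End Put.

(** * Symmetric insertion *)

Record wf E S : Prop := Wf {
  wf_sym : forall u v, (v \in S u) = (u \in S v);
  wf_sub : forall u v, v \in S u -> [set u; v] \in E;
  wf_size : forall u, #|S u| <= b u }.

Lemma edge_neq E u v : simple_graph E -> [set u; v] \in E -> u != v.
Proof. by move=> sE /sE; rewrite cards2; case: (u =P v). Qed.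

Lemma wf_irr E S s : simple_graph E -> wf E S -> s \notin S s.
Proof. by move=> sE wfS; apply/negP=> /(wf_sub wfS) /(edge_neq sE); rewrite eqxx. Qed.

Lemma wf_neq E S s t : simple_graph E -> wf E S -> t \in S s -> s != t.
Proof. by move=> sE wfS; apply: contraL => /eqP<-; apply: wf_irr sE wfS. Qed.

Lemma wf_lmin E S s t : wf E S -> lmin S s = Some t -> t \in S s.
Proof. by move=> wfS; apply: lmin_in; apply: wf_size wfS _. Qed.

Record linkable E S u v : Prop := Linkable {
  lk_simple : simple_graph E;
  lk_wf : wf E S;
  lk_edge : [set u; v] \in E;
  lk_new : v \notin S u }.

(* Symmetric insertion of uv in both lists; u and v, when saturated, release their
   lightest partners, and these edges are [dropped]. *)
Definition dropped S u v s t : bool :=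
  [|| (s == u) && (lmin S u == Some t), (t == u) && (lmin S u == Some s),
      (s == v) && (lmin S v == Some t) | (t == v) && (lmin S v == Some s)].

(** A membership formula makes symmetry visible; [relinkE] identifies it with the two insertions and
    two removals of the algorithm. *)
Definition relink S u v : lists :=
  [ffun s => [set t | [|| (s == u) && (t == v), (s == v) && (t == u)
                        | (t \in S s) && ~~ dropped S u v s t]]].

Lemma in_relink S u v s t : (t \in relink S u v s) =
  [|| (s == u) && (t == v), (s == v) && (t == u) | (t \in S s) && ~~ dropped S u v s t].
Proof. by rewrite ffunE inE. Qed.

Lemma droppedC S u v s t : dropped S u v s t = dropped S u v t s.
Proof. by rewrite /dropped; do 4!case: (_ && _). Qed.

Section Step.
Variables (E : {set {set V}}) (S : @lists d V) (u v : V).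
Hypothesis L : linkable E S u v.

Let sE : simple_graph E := lk_simple L.
Let wfS : wf E S := lk_wf L.
Let uvE : [set u; v] \in E := lk_edge L.
Let vS : v \notin S u := lk_new L.
Let uv : u != v := edge_neq sE uvE.
Let uS : u \notin S v.
Proof. by rewrite -(wf_sym wfS). Qed.
Let szS := wf_size wfS.
Let irr s : s \notin S s := wf_irr s sE wfS.

Let lmin_uv s x : (s == u) || (s == v) -> lmin S s = Some x -> (x != u) && (x != v).
Proof.
move=> hs /(wf_lmin wfS) xS; apply/andP; split; apply: contraTneq xS => ->;
  by case/orP: hs => /eqP->; rewrite ?irr.
Qed.

Lemma relink_l : relink S u v u = put S u v.
Proof.
apply/setP=> t; rewrite in_relink eqxx (negbTE uv) /= /put !inE /dropped eqxx.
have [->//|tv] /= := eqVneq t v.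
have [->|tu] := eqVneq t u.
  by rewrite (negbTE (irr u)) (negbTE (contra (subsetP (del_sub _ _) _) (irr u))).
rewrite (negbTE uv) /= orbF; case e: (lmin S u) => [m|] /=; last by rewrite andbT.
by rewrite !inE andbC eq_sym.
Qed.

Lemma relink_r : relink S u v v = put S v u.
Proof.
apply/setP=> t; rewrite in_relink eqxx eq_sym (negbTE uv) /= /put !inE /dropped eqxx.
have [->|tu] //= := eqVneq t u.
rewrite eq_sym (negbTE uv) /=.
have [->|tv] := eqVneq t v.
  by rewrite (negbTE (irr v)) (negbTE (contra (subsetP (del_sub _ _) _) (irr v))).
rewrite /= orbF; case e: (lmin S v) => [m|] /=; last by rewrite andbT.
by rewrite !inE andbC eq_sym.
Qed.

Lemma relink_other s : s != u -> s != v -> relink S u v s =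
  (S s :\: [set t | (t == u) && (lmin S u == Some s)])
       :\: [set t | (t == v) && (lmin S v == Some s)].
Proof.
move=> su sv; apply/setP=> t; rewrite in_relink (negbTE su) (negbTE sv) /= !inE /dropped.
rewrite (negbTE su) (negbTE sv) /= negb_or.
by case: (t \in S s); rewrite ?andbT ?andbF //= andbC.
Qed.

Definition drops s : nat := (lmin S u == Some s) + (lmin S v == Some s).

Lemma drops_uv s : (s == u) || (s == v) -> drops s = 0.
Proof.
move=> h; rewrite /drops.
have [/(lmin_uv (s := u))|_] := eqVneq (lmin S u) (Some s).
  by rewrite eqxx => /(_ isT); case/orP: h => /eqP->; rewrite eqxx ?andbF.
have [/(lmin_uv (s := v))|//] := eqVneq (lmin S v) (Some s).
by rewrite eqxx orbT => /(_ isT); case/orP: h => /eqP->; rewrite eqxx ?andbF.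
Qed.

Let relinkD1 s : s != u -> s != v -> relink S u v s =
  (if lmin S v == Some s then (if lmin S u == Some s then S s :\ u else S s) :\ v
   else if lmin S u == Some s then S s :\ u else S s).
Proof.
move=> su sv; rewrite relink_other //.
have h y o (A : {set V}) : A :\: [set t | (t == y) && (o == Some s)]
                 = if o == Some s then A :\ y else A.
  by case: ifP => _; apply/setP=> t; rewrite !inE ?andbT // andbF.
by rewrite !h.
Qed.

Lemma card_relink s : s != u -> s != v -> #|relink S u v s| + drops s = #|S s|.
Proof.
move=> su sv; rewrite relinkD1 // /drops.
have hu : lmin S u = Some s -> u \in S s by move/(wf_lmin wfS); rewrite (wf_sym wfS).
have hv : lmin S v = Some s -> v \in S s by move/(wf_lmin wfS); rewrite (wf_sym wfS).
have [/hv e1|_] := eqVneq (lmin S v); have [/hu e2|_] := eqVneq (lmin S u) => //=.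
- have := cardsD1 v (S s :\ u); have := cardsD1 u (S s).
  by rewrite !inE e1 e2 eq_sym uv /= => -> ->; rewrite addnC addnA.
- by have := cardsD1 v (S s); rewrite e1 => ->; rewrite addnC.
- by have := cardsD1 u (S s); rewrite e2 => ->; rewrite addn0 addnC.
by rewrite !addn0.
Qed.

Lemma cnt_relink s t : s != u -> s != v ->
  cnt (S s) s t <= cnt (relink S u v s) s t + drops s.
Proof.
move=> su sv; rewrite relinkD1 // /drops.
have D y A : cnt A s t <= cnt (A :\ y) s t + 1.
  by apply: leq_trans (cntD1 _ _ _ y) _; rewrite leq_add2l; case: (_ \in _).
case: (lmin S v == _); case: (lmin S u == _) => //=.
- apply: leq_trans (D u _) _; rewrite addnA leq_add2r; exact: D.
by rewrite !addn0.
Qed.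

Lemma wf_relink : wf E (relink S u v).
Proof.
split=> [s t|s t|s].
- rewrite !in_relink droppedC (wf_sym wfS s t).
  by rewrite (andbC (t == u)) (andbC (t == v)) orbCA.
- rewrite in_relink => /or3P[/andP[/eqP-> /eqP->]//|/andP[/eqP-> /eqP->]|/andP[]].
    by rewrite setUC.
  by move=> /(wf_sub wfS).
have [->|su] := eqVneq s u; first by rewrite relink_l card_put // geq_minl.
have [->|sv] := eqVneq s v; first by rewrite relink_r card_put // geq_minl.
by apply: leq_trans (szS s); rewrite -(card_relink su sv) leq_addr.
Qed.

(** Inserting at [u] leaves the list of [v] untouched, and the released vertices are neither [u] nor
    [v], so the four operations do not interfere. *)
Lemma relinkE (S1 := set_list S u (put S u v)) (S2 := set_list S1 v (put S v u)) :
  [/\ insert w b S u v = (lmin S u, S1), insert w b S1 v u = (lmin S v, S2)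
    & remove_opt (remove_opt S2 (lmin S u) u) (lmin S v) v = relink S u v].
Proof.
have vu : v != u by rewrite eq_sym.
have S1v : S1 v = S v by rewrite ffunE (negbTE vu).
have lminv : lmin S1 v = lmin S v by rewrite /Defs.lmin /saturated S1v.
have S2v : S2 v = put S v u by rewrite ffunE eqxx.
have S2u : S2 u = put S u v by rewrite !ffunE (negbTE uv) eqxx.
have S2s s : s != u -> s != v -> S2 s = S s.
  by move=> su sv; rewrite !ffunE (negbTE su) (negbTE sv).
split; first exact: insertE.
  by rewrite insertE lminv /put lminv S1v.
have rem o y (T : @lists d V) s : remove_opt T o y s = if o == Some s then T s :\ y else T s.
  case: o => //= r; rewrite ffunE (_ : (Some r == Some s) = (s == r)) 1?eq_sym //.
  by case: eqP => // ->.
apply/ffunP=> s; rewrite !rem.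
have [su|su] := eqVneq s u.
  have := @drops_uv s; rewrite su eqxx /drops => /(_ isT).
  by case: eqP; case: eqP => // _ _ _; rewrite relink_l S2u.
have [sv|sv] := eqVneq s v.
  have := @drops_uv s; rewrite sv eqxx orbT /drops => /(_ isT).
  by case: eqP; case: eqP => // _ _ _; rewrite relink_r S2v.
by rewrite relinkD1 // S2s.
Qed.

End Step.

(** * Stable lists *)

Definition acc S u v : bool := cnt (S u) u v < b u.

Definition stable E S : Prop :=
  wf E S /\ forall u v, [set u; v] \in E -> v \notin S u -> acc S u v -> acc S v u -> False.

Definition agree (S0 : lists) K S : Prop :=
  forall s t, K <= rk s t -> (t \in S s) = (t \in S0 s).

(** The bound is the successor of the rank because only strictly heavier pairs are counted. *)
Lemma agree_cnt S0 K S u v : agree S0 K S -> K <= (rk u v).+1 ->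
  cnt (S u) u v = cnt (S0 u) u v.
Proof.
move=> ag le; apply: eq_card => x; rewrite !inE.
by case: ltnP => h; rewrite ?andbF // !andbT ag // (leq_trans le).
Qed.

Lemma agree_acc S0 K S u v : agree S0 K S -> K <= (rk u v).+1 -> acc S u v = acc S0 u v.
Proof. by rewrite /acc => ag /(agree_cnt ag) ->. Qed.

Lemma stable_blocking E S0 K S u v : stable E S0 -> agree S0 K S -> K <= rk u v ->
  [set u; v] \in E -> v \notin S u -> acc S u v -> acc S v u -> False.
Proof.
move=> [_ st] ag le uvE vS; rewrite (agree_acc ag (leqW le)) (agree_acc ag) 1?rkC ?leqW //.
by apply: st => //; rewrite -ag.
Qed.

(** Otherwise [uv] would block [S0]: in [S] it occupies a slot at each end, and the heavier entries
    are the same in both families, so each end of [S0] counts fewer than its capacity. *)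
Lemma stable_mem E S0 S u v : stable E S0 -> wf E S -> agree S0 (rk u v).+1 S ->
  v \in S u -> v \in S0 u.
Proof.
move=> st wfS ag vS; apply/negPn/negP => vS0.
have full x y : rk x y = rk u v -> y \in S x -> y \notin S0 x -> acc S0 x y.
  move=> e yS yS0; rewrite /acc -(agree_cnt ag) ?e //.
  by apply: leq_trans (wf_size wfS x); apply: cnt_lt yS _.
case: (st) => wf0 bl; apply: (bl u v) => //.
- exact: wf_sub wfS _ _ vS.
- exact: full.
- by apply: full; rewrite 1?rkC // -1?(wf_sym wfS) // -(wf_sym wf0).
Qed.

Lemma stable_uniq E S S' : stable E S -> stable E S' -> S = S'.
Proof.
move=> st st'; apply/ffunP=> u; apply/setP=> v; move: u v; apply: (@rk_ind) => u v IH.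
have ag : agree S' (rk u v).+1 S by move=> s t /IH.
have ag' : agree S (rk u v).+1 S' by move=> s t /IH.
apply/idP/idP; [exact: stable_mem st' (proj1 st) ag | exact: stable_mem st (proj1 st') ag'].
Qed.

Lemma dropped_rk E S u v s t : wf E S -> v \notin S u -> acc S u v -> acc S v u ->
  dropped S u v s t -> rk s t < rk u v.
Proof.
move=> wfS vS au av.
have uS : u \notin S v by rewrite -(wf_sym wfS).
have hu x : lmin S u = Some x -> rk u x < rk u v.
  by move=> h; apply: lmin_lt h _; rewrite ?(wf_size wfS).
have hv x : lmin S v = Some x -> rk v x < rk u v.
  by rewrite (rkC u) => h; apply: lmin_lt h _; rewrite ?(wf_size wfS).
by case/or4P=> /andP[/eqP-> /eqP]; rewrite 1?[rk s _]rkC; auto.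
Qed.

(** Acceptance is assumed at [v], while the release at [u] is excluded by the last two hypotheses;
    the lemma thus covers a saturated [u] taking a lighter partner. *)
Lemma relink_above E S u v s t : wf E S -> v \notin S u -> acc S v u -> rk u v < rk s t ->
  (s = u -> lmin S u != Some t) -> (t = u -> lmin S u != Some s) ->
  (t \in relink S u v s) = (t \in S s).
Proof.
move=> wfS vS av lt ns nt; rewrite in_relink.
have ne x y : rk x y <= rk u v -> (s == x) && (t == y) = false.
  by move=> le; apply/negP => /andP[/eqP es /eqP et]; move: lt; rewrite es et ltnNge le.
rewrite (ne u v) // (ne v u) ?(rkC v) //= andb_idr // => _; apply: contraL lt; rewrite -leqNgt.
have hv x : lmin S v = Some x -> rk v x <= rk u v.
  move=> e; rewrite (rkC u) ltnW //.
  by apply: (lmin_lt (wf_size wfS v) _ e av); rewrite -(wf_sym wfS).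
case/or4P=> /andP[/eqP e1 /eqP e2].
- by move: (ns e1); rewrite e2 eqxx.
- by move: (nt e1); rewrite e2 eqxx.
- by rewrite e1 hv.
- by rewrite e1 rkC hv.
Qed.

(** Since [uv] blocks [S], its rank is below [K] by [stable_blocking], and the released edges are
    lighter still. *)
Lemma agree_relink E S0 K S u v : stable E S0 -> wf E S -> agree S0 K S ->
  [set u; v] \in E -> v \notin S u -> acc S u v -> acc S v u ->
  agree S0 K (relink S u v).
Proof.
move=> st wfS ag uvE vS au av s t le.
have lt : rk u v < K.
  by rewrite ltnNge; apply/negP => h; apply: (stable_blocking st ag h uvE).
rewrite -ag //; apply: (relink_above wfS vS av (leq_trans lt le)) => es; apply/eqP => em.
  have : dropped S u v s t by rewrite /dropped es em !eqxx.
  by move=> /(dropped_rk wfS vS au av) lt'; move: (ltn_trans lt' lt); rewrite ltnNge le.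
have : dropped S u v s t by rewrite /dropped es em !eqxx orbT.
by move=> /(dropped_rk wfS vS au av) lt'; move: (ltn_trans lt' lt); rewrite ltnNge le.
Qed.

Definition phi S : nat := \sum_(p : V * V | p.2 \in S p.1) 5 ^ rk p.1 p.2.

Lemma phi_max S : phi S <= \sum_(p : V * V) 5 ^ rk p.1 p.2.
Proof.
rewrite /phi [X in _ <= X](bigID (fun p : V * V => p.2 \in S p.1)) /=; exact: leq_addr.
Qed.

Lemma phi_relink E S u v : simple_graph E -> wf E S -> [set u; v] \in E ->
  v \notin S u -> acc S u v -> acc S v u -> phi S < phi (relink S u v).
Proof.
move=> sE wfS uvE vS au av; set S' := relink S u v.
have uv := edge_neq sE uvE.
pose old (p : V * V) := p.2 \in S p.1; pose new (p : V * V) := p.2 \in S' p.1.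
rewrite /phi (bigID new) [X in _ < X](bigID old) /=.
rewrite (eq_bigl (fun p : V * V => new p && old p)); last by move=> p; rewrite andbC.
rewrite ltn_add2l.
set D := \sum_(p | old p && ~~ new p) _.
(* At most four ordered pairs disappear, each weighing at most a fifth of [5 ^ rk u v]; the pairs
   [(u, v)] and [(v, u)] bring in twice [5 ^ rk u v]. *)
have D4 : 5 * D <= 4 * 5 ^ rk u v.
  pose x := odflt u (lmin S u); pose z := odflt v (lmin S v).
  pose L := [:: (u, x); (x, u); (v, z); (z, v)].
  have dL p : old p && ~~ new p -> dropped S u v p.1 p.2 /\ p \in L.
    case: p => s t; rewrite /old /new /S' in_relink /= => /andP[-> /=].
    rewrite 2!negb_or negbK => /and3P[_ _ dr]; split=> //.
    move: dr; rewrite /dropped !inE /x /z.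
    by case/or4P=> /andP[/eqP-> /eqP->] /=; rewrite eqxx ?orbT.
  rewrite /D big_distrr /=.
  apply: leq_trans (_ : \sum_(p | old p && ~~ new p) 5 ^ rk u v <= _).
    apply: leq_sum => p /dL[/(dropped_rk wfS vS au av) lt _].
    by rewrite -expnS leq_exp2l.
  rewrite sum_nat_const leq_mul2r; apply/orP; right.
  apply: leq_trans (card_size L); apply: subset_leq_card.
  by apply/subsetP=> p /dL[].
have N2 : 2 * 5 ^ rk u v <= \sum_(p | new p && ~~ old p) 5 ^ rk p.1 p.2.
  rewrite (bigD1 (u, v)) /=; last first.
    by rewrite /new /old /S' in_relink /= !eqxx vS.
  rewrite (bigD1 (v, u)) /=; last first.
    rewrite /new /old /S' in_relink /= !eqxx orbT -(wf_sym wfS) vS /=.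
    by rewrite xpair_eqE negb_and eq_sym uv.
  by rewrite (rkC v u) addnA mul2n -addnn leq_addr.
have p : 0 < 5 ^ rk u v by rewrite expn_gt0.
move: D D4 N2 p => D; set X := \sum_(p | _) _; move: X => X.
lia.
Qed.

Lemma wf_accepts E S u v : wf E S -> v \notin S u -> accepts S v u = acc S v u.
Proof. by move=> wfS vS; rewrite acceptsE ?(wf_size wfS) // -(wf_sym wfS). Qed.

Lemma partner_Some E S u v : wf E S -> partner E S u = Some v ->
  [/\ [set u; v] \in E, v \notin S u, acc S v u
    & forall t, [set u; t] \in E -> t \notin S u -> acc S t u -> t != v -> rk u t < rk u v].
Proof.
move=> wfS /argmax_Some[]; rewrite !inE => /andP[/andP[vS uvE]].
rewrite (wf_accepts wfS vS) => av max; split=> // t utE tS at_ tv.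
by apply: max tv; rewrite !inE tS utE (wf_accepts wfS).
Qed.

Lemma partner_None E S u t : wf E S -> partner E S u = None ->
  [set u; t] \in E -> t \notin S u -> acc S t u -> False.
Proof.
move=> wfS /argmax_None/setP/(_ t); rewrite !inE => h utE tS at_.
by move: h; rewrite tS utE (wf_accepts wfS tS) at_.
Qed.

Lemma partner_ex E S u t : wf E S -> [set u; t] \in E -> t \notin S u -> acc S t u ->
  exists v, partner E S u = Some v.
Proof.
move=> wfS utE tS at_; case e: (partner E S u) => [v|]; first by exists v.
by have := partner_None wfS e utE tS at_.
Qed.

(** * The invariant with discounted slots, relative to a fixed stable family *)

Section Repair.
Variables (E : {set {set V}}) (S0 : @lists d V).
Hypotheses (sE : simple_graph E) (stS0 : stable E S0).

(* uv is the heaviest edge on which S and S0 differ. *)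
Definition top S u v : Prop := [/\ v \in S0 u, v \notin S u & agree S0 (rk u v).+1 S].

Lemma topC S u v : wf E S -> top S u v -> top S v u.
Proof.
move=> wfS [h1 h2 h3]; split; last by rewrite rkC.
  by rewrite (wf_sym (proj1 stS0)).
by rewrite (wf_sym wfS).
Qed.

Lemma top_acc S u v : top S u v -> acc S u v.
Proof.
case=> h1 h2 ag; rewrite (agree_acc ag) // /acc.
by apply: leq_trans (wf_size (proj1 stS0) u); apply: cnt_lt h1 _.
Qed.

(** A choice heavier than [v] would be a blocking edge above the highest disagreement, which
    [stable_blocking] forbids. *)
Lemma top_partner S u v : wf E S -> top S u v -> partner E S u = Some v.
Proof.
move=> wfS tp; have tp' := topC wfS tp; case: (tp) => v0 vS ag.
have uvE := wf_sub (proj1 stS0) v0.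
have [t e] := partner_ex wfS uvE vS (top_acc tp'); rewrite e.
have [utE tS at_ max] := partner_Some wfS e.
have [->//|tv] := eqVneq t v.
have lt : rk u v < rk u t by apply: max => //; [exact: top_acc | rewrite eq_sym].
have au : acc S u t.
  apply: leq_ltn_trans (top_acc tp); apply: subset_leq_card; apply/subsetP=> x.
  by rewrite !inE => /andP[-> /(ltn_trans lt)->].
by have := stable_blocking stS0 ag lt utE tS au at_.
Qed.

(* h s is the number of slots at s that are discounted because the algorithm has
   still to fill them.  The edge [top] is exempted: it is the one lost when a
   saturated vertex takes a lighter partner. *)
Definition inv (h : V -> nat) S : Prop :=
  wf E S /\ forall s t, [set s; t] \in E -> t \notin S s ->
    cnt (S s) s t + h s < b s -> cnt (S t) t s + h t < b t -> top S s t /\ 0 < h s + h t.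

Definition mark u s : nat := s == u.
Definition omark o s : nat := o == Some s.

Lemma inv_stable S : inv (fun _ => 0) S <-> stable E S.
Proof.
split=> -[wfS bl]; split=> // s t stE tS a1 a2.
  by have [] := bl s t stE tS; rewrite ?addn0.
by case: (bl s t stE tS); rewrite /acc -[cnt _ _ _]addn0.
Qed.

Lemma eq_inv h h' S : h =1 h' -> inv h S -> inv h' S.
Proof. by move=> e [wfS bl]; split=> // s t; rewrite -!e; apply: bl. Qed.

(** No neighbor outside the list of [u] accepts [u], so no edge at [u] blocks and the discount at
    [u] can be lifted. *)
Lemma inv_partner_None h S u : inv (fun s => h s + mark u s) S ->
  partner E S u = None -> inv h S.
Proof.
move=> [wfS bl] e; split=> // s t stE tS a1 a2.
have acc_h x y : cnt (S x) x y + h x < b x -> acc S x y by apply: leq_ltn_trans; apply: leq_addr.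
have [su|su] := eqVneq s u.
  by have := partner_None wfS e (t := t); rewrite -su => /(_ stE tS (acc_h _ _ a2)).
have [tu|tu] := eqVneq t u.
  have := partner_None wfS e (t := s); rewrite -tu setUC => /(_ stE).
  by rewrite (wf_sym wfS) => /(_ tS (acc_h _ _ a1)).
by have := bl s t stE tS; rewrite /mark (negbTE su) (negbTE tu) !addn0; apply.
Qed.

Section StepInv.
Variables (S : @lists d V) (u v : V).
Hypotheses (wfS : wf E S) (uvP : partner E S u = Some v).

Let S' := relink S u v.
Let uvE : [set u; v] \in E. Proof. by case: (partner_Some wfS uvP). Qed.
Let vS : v \notin S u. Proof. by case: (partner_Some wfS uvP). Qed.
Let av : acc S v u. Proof. by case: (partner_Some wfS uvP). Qed.
Let uS : u \notin S v. Proof. by rewrite -(wf_sym wfS). Qed.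
Let uv : u != v := edge_neq sE uvE.
Let L : linkable E S u v := Linkable sE wfS uvE vS.

(** Away from [v], the entries lost are compensated by [drops]; at [v] the threshold has only risen.
    Hence the step makes nothing newly acceptable at [s]. *)
Let acc_other (h : V -> nat) s t : s != u -> cnt (S' s) s t + (h s + drops S u v s) < b s ->
  cnt (S s) s t + h s < b s /\ (s = v -> lmin S v != Some t).
Proof.
move=> su; have [sv|sv] := eqVneq s v; last first.
  move=> lt; split=> [|/eqP]; last by rewrite (negbTE sv).
  have := cnt_relink S t su sv.
  by rewrite -/S' => le; apply: leq_ltn_trans lt; rewrite addnCA addnC leq_add2l.
rewrite sv (drops_uv L) ?eqxx ?orbT // addn0 /S' (relink_r L) => lt.
have [] := @cnt_put S v u (wf_size wfS v) uS t av.
  by apply: leq_ltn_trans lt; apply: leq_addr.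
move=> le ne; split=> //; apply: leq_ltn_trans lt; rewrite leq_add2r.
by apply: leq_trans le; apply: leq_addr.
Qed.

Let kept_or_lighter (h : V -> nat) t : t != v -> [set u; t] \in E -> t \notin S u ->
  cnt (S' t) t u + (h t + drops S u v t) < b t -> rk u t < rk u v.
Proof.
move=> tv utE tS lt; have [_ _ _ max] := partner_Some wfS uvP; apply: max => //.
have [|le _] := acc_other _ lt; first by rewrite eq_sym (edge_neq sE utE).
by apply: leq_ltn_trans le; apply: leq_addr.
Qed.

Let mem_relink s t : t \notin S' s ->
  [/\ ~~ ((s == u) && (t == v)), ~~ ((s == v) && (t == u)) & (t \in S s) ==> dropped S u v s t].
Proof. by rewrite in_relink 2!negb_or 1?[X in _ && (_ && X)]negb_and negbK implybE => /and3P[]. Qed.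

Let acc_u (h : V -> nat) t : acc S u v -> t \notin S' u -> [set u; t] \in E ->
  cnt (S' u) u t + (h u + drops S u v u) < b u ->
  cnt (S' t) t u + (h t + drops S u v t) < b t ->
  lmin S u != Some t /\ (t \notin S u -> cnt (S u) u t + (h u + 1) < b u).
Proof.
move=> au /mem_relink[tv _ _] utE lt lt'; rewrite eqxx /= in tv.
move: lt; rewrite (drops_uv L) ?eqxx // addn0 /S' (relink_l L) => lt.
have [] := @cnt_put S u v (wf_size wfS u) vS t au.
  by apply: leq_ltn_trans lt; apply: leq_addr.
move=> le ne; split=> // tS; move: le; rewrite (kept_or_lighter tv utE tS lt') /= => le.
by apply: leq_ltn_trans lt; rewrite addnCA [X in _ <= X]addnC leq_add2l.
Qed.

(** The new partner fills the slot discounted at [u]: any other neighbor still willing is lighter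
    than [v], so [v] is counted against it. The discount moves on to the released vertices. *)
Lemma inv_good h : acc S u v -> inv (fun s => h s + mark u s) S ->
  inv (fun s => h s + drops S u v s) S'.
Proof.
move=> au [_ bl]; split; first exact: wf_relink L.
move=> s t stE tS a1 a2.
have wf' : wf E S' := wf_relink L.
have sS : s \notin S' t by rewrite -(wf_sym wf').
have tsE : [set t; s] \in E by rewrite setUC.
have half x y : [set x; y] \in E -> y \notin S' x ->
    cnt (S' x) x y + (h x + drops S u v x) < b x ->
    cnt (S' y) y x + (h y + drops S u v y) < b y ->
    (x = u -> lmin S u != Some y) /\ (x = v -> lmin S v != Some y) /\
    (y \notin S x -> cnt (S x) x y + (h x + mark u x) < b x).
  move=> xyE yS b1 b2; rewrite /mark; have [xu|xu] := eqVneq x u.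
    move: xyE yS b1 b2; rewrite xu => xyE yS b1 b2.
    have [h1 h2] := acc_u au yS xyE b1 b2; split=> //; split=> // /eqP.
    by rewrite (negbTE uv).
  have [h1 h2] := acc_other xu b1; split=> [/eqP|]; first by rewrite (negbTE xu).
  by split=> // _; rewrite addn0.
have [n1 [n2 n3]] := half _ _ stE tS a1 a2.
have [m1 [m2 m3]] := half _ _ tsE sS a2 a1.
have ndr : ~~ dropped S u v s t.
  by apply/negP=> /or4P[] /andP[/eqP e]; apply/negP; auto.
have [_ _] := mem_relink tS; rewrite (negbTE ndr) implybF => tSs.
have sSt : s \notin S t by rewrite -(wf_sym wfS).
have [tp pos] := bl s t stE tSs (n3 tSs) (m3 sSt).
have agS' : agree S0 (rk s t).+1 S'.
  by case: tp => _ _ ag; exact: (agree_relink stS0 wfS ag uvE vS au av).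
split; first by case: tp => t0 _ _; split.
(* If the exempted edge met [u], [partner] would have chosen it and the step would have linked it;
   so its discount lies elsewhere and survives. *)
have [su|su] := eqVneq s u.
  have : partner E S u = Some t by rewrite -su; apply: top_partner.
  by rewrite uvP => -[vt]; have [/negP[]] := mem_relink tS; apply/andP; split; apply/eqP.
have [tu|tu] := eqVneq t u.
  have : partner E S u = Some s by rewrite -tu; apply: top_partner; [|exact: topC].
  by rewrite uvP => -[vt]; have [_ /negP[]] := mem_relink tS; apply/andP; split; apply/eqP.
move: pos; rewrite /mark (negbTE su) (negbTE tu) !addn0 => pos.
by apply: leq_trans pos _; apply: leq_add; apply: leq_addr.
Qed.

Lemma bad_lmin : ~~ acc S u v ->
  exists m, [/\ lmin S u = Some m, m \in S u, #|S u| = b u & rk u v < rk u m].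
Proof.
rewrite /acc -leqNgt => nau; have lt_m := cnt_geP nau (wf_size wfS u).
case: (lminP (wf_size wfS u)) => [lt|m bm mS _]; last by exists m; split=> //; apply: lt_m.
by have := leq_trans nau (cnt_le _ _ _); rewrite leqNgt lt.
Qed.

(** The lost edge [um] is heavier than [uv], and the edge given up by [v] is lighter than [uv], so
    [um] is the heaviest change. *)
Lemma bad_top m : S = S0 -> ~~ acc S u v -> lmin S u = Some m -> top S' u m.
Proof.
move=> SS0 /bad_lmin[m' [em mS _ lt_m]]; rewrite em => -[e]; move: e em mS lt_m => -> em mS lt_m.
have mu : m != u by rewrite eq_sym (wf_neq sE wfS).
have mv : m != v by apply: contraNneq vS => <-.
split; first by rewrite -SS0.
  by rewrite in_relink eqxx (negbTE mv) (negbTE uv) mS /dropped eqxx em eqxx.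
move=> s t lt; rewrite -SS0.
apply: (relink_above wfS vS av (ltn_trans lt_m lt)).
  by move=> su; apply/eqP; rewrite em => -[mt]; rewrite su -mt ltnn in lt.
by move=> tu; apply/eqP; rewrite em => -[ms]; rewrite tu -ms rkC ltnn in lt.
Qed.

(** Now [u] only takes partners at least as heavy as [v], while the other neighbors willing to take
    [u] are lighter: no edge absent from [S0] blocks at [u]. Among the lost edges only [um] can
    block, since [v] does not want its released partner back. *)
Lemma inv_bad : S = S0 -> ~~ acc S u v -> inv (drops S u v) S'.
Proof.
move=> SS0 nau; split; first exact: wf_relink L.
have stS : stable E S by rewrite SS0.
have [m [em _ _ _]] := bad_lmin nau; have top_um := bad_top SS0 nau em.
have wf' : wf E S' := wf_relink L.
have noacc t : [set u; t] \in E -> t \notin S' u -> t \notin S u ->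
    cnt (S' u) u t + drops S u v u < b u -> cnt (S' t) t u + drops S u v t < b t -> False.
  move=> utE /mem_relink[tv _ _] tS; rewrite (drops_uv L) ?eqxx // addn0 /S' (relink_l L) => b1 b2.
  rewrite eqxx /= in tv.
  have := nau; rewrite /acc -leqNgt => /(@cnt_put_bad S u v (wf_size wfS u) vS t)/(_ b1).
  by rewrite leqNgt (kept_or_lighter (h := fun=> 0) tv utE tS).
have exempt x y : [set x; y] \in E -> y \notin S' x ->
    cnt (S' x) x y + drops S u v x < b x -> cnt (S' y) y x + drops S u v y < b y ->
    y \in S x -> (x = u /\ y = m) \/ (y = u /\ x = m).
  move=> xyE yS b1 b2 yx; have [_ _] := mem_relink yS; rewrite yx /= => dr.
  have [xu|xu] := eqVneq x u.
    left; split=> //; move: dr; rewrite /dropped xu eqxx em (negbTE uv) /=.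
    have yu : y != u by rewrite eq_sym -xu (wf_neq sE wfS).
    rewrite (negbTE yu) /= => /orP[/eqP[->]//|/andP[/eqP yv]].
    by move: yx; rewrite xu yv (negbTE vS).
  have [_ nx] := acc_other (h := fun=> 0) xu b1.
  have [yu|yu] := eqVneq y u.
    right; split=> //; move: dr; rewrite /dropped (negbTE xu) yu eqxx em (negbTE uv) /= orbF.
    case/orP=> [/eqP[->]//|/andP[/eqP xv /eqP ez]].
    by move: yx; rewrite xv yu (negbTE uS).
  have [_ ny] := acc_other (h := fun=> 0) yu b2.
  move: dr; rewrite /dropped (negbTE xu) (negbTE yu) /=.
  by case/orP=> /andP[/eqP xv ez]; [move: (nx xv)|move: (ny xv)]; rewrite ez.
move=> s t stE tS a1 a2.
have tsE : [set t; s] \in E by rewrite setUC.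
have [tSs|tSs] := boolP (t \in S s).
  have drm : 0 < drops S u v m by rewrite /drops em eqxx.
  have [] := exempt s t stE tS a1 a2 tSs => -[-> ->]; split=> //; try by rewrite ltn_addl.
    exact: topC.
  by rewrite ltn_addr.
exfalso; have sSt : s \notin S t by rewrite -(wf_sym wfS).
have sS : s \notin S' t by rewrite -(wf_sym wf').
have [su|su] := eqVneq s u.
  by move: stE tS a1 a2 tSs; rewrite su => x1 x2 x3 x4 x5; apply: (noacc t).
have [tu|tu] := eqVneq t u.
  by move: tsE sS a1 a2 sSt; rewrite tu => x1 x2 x3 x4 x5; apply: (noacc s).
have [] := acc_other (h := fun=> 0) su a1; rewrite addn0 => b1 _.
have [] := acc_other (h := fun=> 0) tu a2; rewrite addn0 => b2 _.
by case: stS => _ bl; apply: (bl s t).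
Qed.

End StepInv.

(** * Repairing vacancies *)

Lemma affected_stepE S u v l : wf E S -> partner E S u = Some v ->
  affected_step w b S u v l =
    (lmin S v, if lmin S u is Some y then Some y else l, relink S u v).
Proof.
move=> wfS /(partner_Some wfS)[uvE vS _ _].
by have [e1 e2 e3] := relinkE (Linkable sE wfS uvE vS); rewrite /affected_step e1 e2 e3.
Qed.

(** The same [l] stands before and after: displaced vertices have a vacant slot, so passes starting
    from them leave [looseEnd] unchanged. *)
Definition loop_from S o l S' : Prop :=
  if o is Some z then affected_loop w b E S z l S' l else S' = S.

Lemma loop_step S u v l S' (l' := if lmin S u is Some y then Some y else l) :
  wf E S -> partner E S u = Some v -> loop_from (relink S u v) (lmin S v) l' S' ->
  affected_loop w b E S u l S' l'.
Proof.
move=> wfS e; have es := affected_stepE l wfS e; rewrite /loop_from.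
case ez: (lmin S v) es => [z|] es; first exact: AffectedNext e es.
by move=> ->; apply: AffectedExit e es.
Qed.

Lemma unsaturated_lmin S u : #|S u| < b u -> lmin S u = None.
Proof. by rewrite /Defs.lmin /saturated ltn_neqAle => /andP[/negbTE-> _]. Qed.

Lemma unsaturated_acc S u v : #|S u| < b u -> acc S u v.
Proof. exact: leq_ltn_trans (cnt_le _ _ _). Qed.

Lemma relink_room S u v z : linkable E S u v ->
  0 < drops S u v z -> #|relink S u v z| < b z.
Proof.
move=> L dz.
have zu : z != u by apply: contraTneq dz => ->; rewrite (drops_uv L) ?eqxx.
have zv : z != v by apply: contraTneq dz => ->; rewrite (drops_uv L) ?eqxx ?orbT.
apply: leq_trans (wf_size (lk_wf L) z); rewrite -(card_relink L zu zv).
by rewrite -addn1 leq_add2l.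
Qed.

(** A vertex with room releases nobody and accepts everybody, so every pass increases [phi], and the
    vertex displaced at the other end has room in turn. *)
Lemma loop_total h K S u l :
  inv (fun s => h s + mark u s) S -> #|S u| < b u -> agree S0 K S ->
  exists S', [/\ affected_loop w b E S u l S' l, inv h S', agree S0 K S' & phi S <= phi S'].
Proof.
have [n] := ubnP (\sum_(p : V * V) 5 ^ rk p.1 p.2 - phi S).
elim: n S u => // n IHn S u lt_n iS room ag; have wfS := proj1 iS.
case e: (partner E S u) => [v|]; last first.
  by exists S; split=> //; [exact: AffectedNone | exact: inv_partner_None iS e].
have [uvE vS av _] := partner_Some wfS e.
have L := Linkable sE wfS uvE vS.
have au := unsaturated_acc v room.
have lu := unsaturated_lmin room.
have i' := inv_good wfS e au iS.
have ag' := agree_relink stS0 wfS ag uvE vS au av.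
have lt_phi := phi_relink sE wfS uvE vS au av.
have step S' := @loop_step S u v l S' wfS e; rewrite lu in step.
case ez: (lmin S v) step => [z|] step; last first.
  exists (relink S u v); split; [exact: step| |by []|exact: ltnW].
  by apply: eq_inv i' => s; rewrite /drops lu ez addn0.
have [|||S' [loop iS' agS' le_phi]] := IHn (relink S u v) z _ _ _ ag'.
- exact: leq_trans (ltn_sub2l (leq_trans lt_phi (phi_max _)) lt_phi) lt_n.
- by apply: eq_inv i' => s; rewrite /drops lu ez /mark [s == z]eq_sym.
- by apply: relink_room => //; rewrite /drops lu ez eqxx.
by exists S'; split=> //; [exact: step | exact: leq_trans (ltnW lt_phi) le_phi].
Qed.

Lemma loop_from_total h K S o l :
  inv (fun s => h s + omark o s) S -> (forall z, o = Some z -> #|S z| < b z) -> agree S0 K S ->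
  exists S', [/\ loop_from S o l S', inv h S', agree S0 K S' & phi S <= phi S'].
Proof.
case: o => [z|] iS room ag; last first.
  by exists S; split=> //; apply: eq_inv iS => s; rewrite addn0.
apply: loop_total; rewrite ?room //; apply: eq_inv iS => s.
by rewrite /mark /omark [s == z]eq_sym.
Qed.

(* x has room for an edge of S0 of rank below K; hence, if S0 saturates x, the
   lightest edge of S0 at x has rank below K. *)
Definition low K x : bool := #|[set v in S0 x | K <= rk x v]| < b x.

Lemma low_agree K S x : agree S0 K S -> #|S x| < b x -> low K x.
Proof.
move=> ag; apply: leq_ltn_trans; apply: subset_leq_card; apply/subsetP=> v.
by rewrite inE => /andP[vx le]; rewrite ag.
Qed.

(** The bound drops by one: by injectivity of the rank, [uv] is the only edge of its rank. *)
Lemma agree_top S u v : wf E S -> top S u v -> agree S0 (rk u v) (relink S u v).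
Proof.
move=> wfS tp s t le; have tp' := topC wfS tp.
have [v0 vS ag] := tp; have uvE := wf_sub (proj1 stS0) v0.
move: le; rewrite leq_eqVlt => /orP[/eqP e|lt]; last first.
  exact: (agree_relink stS0 wfS ag uvE vS (top_acc tp) (top_acc tp') lt).
have u0 : u \in S0 v by rewrite (wf_sym (proj1 stS0)).
have es : [set u; v] = [set s; t] := rk_inj e.
have: s \in [set u; v] by rewrite es set21.
rewrite !inE => /orP[]/eqP su; move: es e; rewrite su => es e.
  by rewrite -(rk_injr e) in_relink !eqxx v0.
have <- : u = t by apply: (@rk_injr v); rewrite -e rkC.
by rewrite in_relink !eqxx u0 !orbT.
Qed.

(** Only the first pass may start at a saturated vertex. Its lightest partner becomes the loose end,
    and the other passes start from vertices with room. *)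
Lemma repair_first K S x v : inv (mark x) S -> partner E S x = Some v -> acc S x v ->
  agree S0 K (relink S x v) ->
  exists S', [/\ affected_loop w b E S x None S' (lmin S x), inv (omark (lmin S x)) S',
    agree S0 K S', phi S < phi S' & forall y, lmin S x = Some y -> low K y].
Proof.
move=> iS e ax ag; have wfS := proj1 iS.
have [xvE vS av _] := partner_Some wfS e.
have L := Linkable sE wfS xvE vS.
have i' : inv (drops S x v) (relink S x v).
  by apply: eq_inv (inv_good (h := fun=> 0) wfS e ax iS) => s; rewrite add0n.
have room z : 0 < drops S x v z -> #|relink S x v z| < b z by apply: relink_room.
have [|S' [loop iS' agS' le_phi]] :=
    @loop_from_total (omark (lmin S x)) K (relink S x v) (lmin S v) (lmin S x) i' _ ag.
  by move=> z ez; apply: room; rewrite /drops ez eqxx addn1.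
exists S'; split=> //.
- have := @loop_step S x v None S' wfS e.
  rewrite (_ : (if lmin S x is Some y then Some y else None) = lmin S x); last by case: lmin.
  exact.
- exact: leq_trans (phi_relink sE wfS xvE vS ax av) le_phi.
by move=> y ey; apply: low_agree ag (room y _); rewrite /drops ey eqxx.
Qed.

(** Since [v] is the heaviest neighbor willing to take [x], rejecting [v] means rejecting all of
    them, so no edge at [x] blocks. Elsewhere nothing is discounted, and the positivity clause of
    [inv] rules out the exemption. *)
Lemma repair_blocked_stable S x v : inv (mark x) S -> partner E S x = Some v -> ~~ acc S x v ->
  stable E S.
Proof.
move=> iS e; rewrite /acc -leqNgt => nax; have wfS := proj1 iS.
have [_ _ _ max] := partner_Some wfS e.
have h t : [set x; t] \in E -> t \notin S x -> acc S x t -> acc S t x -> False.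
  move=> xtE tS axt atx; have [tv|tv] := eqVneq t v.
    by move: axt; rewrite /acc tv ltnNge nax.
  have lt := max t xtE tS atx tv.
  move: axt; rewrite /acc ltnNge => /negP; apply; apply: leq_trans nax _.
  apply: subset_leq_card; apply/subsetP=> y; rewrite !inE => /andP[-> /=].
  exact: ltn_trans.
split=> // s t stE tS a1 a2.
have [sx|sx] := eqVneq s x; first by move: stE tS a1 a2; rewrite sx; apply: h.
have [tx|tx] := eqVneq t x.
  have sSx : s \notin S t by rewrite -(wf_sym wfS).
  by apply: (h s) => //; rewrite -tx // setUC.
have [] := proj2 iS s t stE tS; rewrite /mark ?(negbTE sx) ?(negbTE tx) ?addn0 //.
Qed.

(* q is saturated and takes c, lighter than all its partners, in place of the
   lightest one, m.  Until m is involved, the rest of the loop only affects edges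
   lighter than qc. *)
Section Blocked.
Variables (q c m : V).
Hypotheses (qcP : partner E S0 q = Some c) (nacc : ~~ acc S0 q c) (em : lmin S0 q = Some m).

Let S1 := relink S0 q c.
Let wf0 : wf E S0 := proj1 stS0.
Let qcE : [set q; c] \in E. Proof. by case: (partner_Some wf0 qcP). Qed.
Let cS0 : c \notin S0 q. Proof. by case: (partner_Some wf0 qcP). Qed.
Let acq : acc S0 c q. Proof. by case: (partner_Some wf0 qcP). Qed.
Let L0 : linkable E S0 q c := Linkable sE wf0 qcE cS0.
Let wf1 : wf E S1 := wf_relink L0.
Let top1 : top S1 q m := bad_top wf0 qcP erefl nacc em.

Let facts : [/\ m \in S0 q, #|S0 q| = b q & rk q c < rk q m].
Proof. by have [m' []] := bad_lmin wf0 nacc; rewrite em => -[<-]. Qed.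

(** The rank of [qc] itself is included: this edge has to stay for [q] to remain saturated. *)
Definition near S : Prop := forall s t, rk q c <= rk s t -> (t \in S s) = (t \in S1 s).

Let S1_above s t : rk q c < rk s t -> (s = q -> t != m) -> (t = q -> s != m) ->
  (t \in S1 s) = (t \in S0 s).
Proof.
move=> lt n1 n2; apply: (relink_above wf0 cS0 acq lt).
  by move=> sq; apply/eqP; rewrite em => -[mt]; move: (n1 sq); rewrite mt eqxx.
by move=> tq; apply/eqP; rewrite em => -[mt]; move: (n2 tq); rewrite mt eqxx.
Qed.

Lemma near_top S : near S -> top S m q.
Proof.
move=> nS; have [h1 h2 h3] := topC wf1 top1.
have lt : rk q c < rk m q by have [_ _] := facts; rewrite (rkC m).
split=> //; first by rewrite nS // ltnW.
by move=> s t le; rewrite nS ?h3 // ltnW // (leq_trans lt) // ltnW.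
Qed.

Let near_full S : near S -> b q <= #|S q|.
Proof.
move=> nS; have [_ full _] := facts.
have le : #|S0 q| <= b q by rewrite full.
have <- : #|S1 q| = b q by rewrite (relink_l L0) card_put // full (minn_idPl (leqnSn _)).
apply: subset_leq_card; apply/subsetP=> t tS; rewrite nS //.
move: tS; rewrite (relink_l L0) inE => /orP[/set1P->//|/(subsetP (del_sub _ _))] tS.
by move: nacc; rewrite /acc -leqNgt => /cnt_geP /(_ le _ tS) /ltnW.
Qed.

(** At a vertex other than [q] and [m], entries heavier than [qc] are those of [S0], so a heavier
    choice would block [S0]; if [v = q], it would contradict the choice of [c] as the heaviest
    neighbor willing to take [q]. *)
Let near_partner S u v : inv (fun s => mark m s + mark u s) S -> near S -> partner E S u = Some v ->
  #|S u| < b u -> u != m -> v != m -> rk u v < rk q c.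
Proof.
move=> iS nS e room um vm; have wfS := proj1 iS.
have [uvE vS av _] := partner_Some wfS e; have au := unsaturated_acc v room.
have uq : u != q by apply: contraTneq room => ->; rewrite -leqNgt near_full.
rewrite ltnNge leq_eqVlt; apply/negP => /orP[/eqP e1|lt].
  have : v \notin S1 u by rewrite -nS ?e1.
  have := rk_inj e1 => es; have: u \in [set q; c] by rewrite es set21.
  rewrite !inE (negbTE uq) /= => /eqP uc; move: es e1; rewrite uc => es e1.
  have <- : q = v by apply: (@rk_injr c); rewrite -e1 rkC.
  by rewrite -(wf_sym wf1) in_relink !eqxx.
have vS0 : v \notin S0 u.
  by rewrite -S1_above // -?nS ?(ltnW lt) // => /eqP; rewrite ?(negbTE uq).
have same x y : x != q -> x != m -> rk q c < rk x y -> acc S x y -> acc S0 x y.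
  move=> xq xm lt'; rewrite /acc => h; apply: leq_ltn_trans h.
  apply: subset_leq_card; apply/subsetP=> z; rewrite !inE => /andP[zS lt2].
  rewrite lt2 andbT nS ?S1_above //; try exact: ltn_trans lt2.
  - by move=> /eqP; rewrite (negbTE xq).
  - exact: ltnW (ltn_trans lt' lt2).
have a0 := same u v uq um lt au.
have [vq|vq] := eqVneq v q.
  have [_ _ _ max] := partner_Some wf0 qcP.
  have : rk q u < rk q c \/ u = c.
    have [->|uc] := eqVneq u c; [by right | left; apply: max => //].
    - by rewrite -vq setUC.
    - by rewrite -(wf_sym wf0) -vq.
    - by rewrite -vq.
  case=> [|uc].
    by move: lt; rewrite vq (rkC u) => lt lt'; move: (ltn_trans lt lt'); rewrite ltnn.
  by move: lt; rewrite uc vq (rkC c) ltnn.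
apply: (proj2 stS0 u v uvE vS0 a0); by apply: same; rewrite ?(rkC v).
Qed.

(** If the current vertex is [m], it takes [q] back, as [mq] is the heaviest disagreement; if [m] is
    the vertex chosen, it has room and the loop ends; any other step stays below [qc]. For [u = m]
    the term [mark m u] asks for two vacancies, one to fill now and one for the pending call on
    [m]. *)
Lemma blocked_loop S u : inv (fun s => mark m s + mark u s) S -> near S -> #|S u| < b u ->
    #|S m| + mark m u < b m ->
  exists S', [/\ affected_loop w b E S u (Some m) S' (Some m), inv (mark m) S'
    & top S' m q \/ agree S0 (rk m q) S' /\ low (rk m q) m].
Proof.
have [n] := ubnP (\sum_(p : V * V) 5 ^ rk p.1 p.2 - phi S).
elim: n S u => // n IHn S u lt_n iS nS room roomm; have wfS := proj1 iS.
case e: (partner E S u) => [v|]; last first.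
  exists S; split; [exact: AffectedNone | exact: inv_partner_None iS e |].
  by left; apply: near_top.
have [uvE vS av _] := partner_Some wfS e.
have L := Linkable sE wfS uvE vS.
have au := unsaturated_acc v room.
have lu := unsaturated_lmin room.
have i' := inv_good wfS e au iS.
have lt_phi := phi_relink sE wfS uvE vS au av.
have step S' := @loop_step S u v (Some m) S' wfS e; rewrite lu in step.
have i2 : inv (fun s => mark m s + omark (lmin S v) s) (relink S u v).
  by apply: eq_inv i' => s; rewrite /drops lu.
have room' z : lmin S v = Some z -> #|relink S u v z| < b z.
  by move=> ez; apply: relink_room => //; rewrite /drops ez eqxx addn1.
have tm := near_top nS.
have [um|um] := eqVneq u m.
  have vq : v = q by move: (top_partner wfS tm); rewrite -um e => -[].
  have ag : agree S0 (rk m q) (relink S u v) by rewrite um vq; apply: agree_top.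
  have [S' [loop iS' agS' _]] := loop_from_total (Some m) i2 room' ag.
  exists S'; split=> //; first exact: step.
  right; split=> //; apply: low_agree ag _.
  rewrite -um (relink_l L) card_put ?(wf_size wfS) // gtn_min; apply/orP; right.
  by move: roomm; rewrite um /mark eqxx addn1.
have [vm|vm] := eqVneq v m.
  have lv : lmin S v = None.
    by apply: unsaturated_lmin; rewrite vm; apply: leq_ltn_trans roomm; apply: leq_addr.
  exists (relink S u v); split.
  - by apply: step; rewrite lv.
  - by apply: eq_inv i2 => s; rewrite lv addn0.
  left; have [h1 h2 h3] := tm; split=> //; last first.
    exact: (agree_relink stS0 wfS h3 uvE vS au av).
  have uq : u != q by apply: contraTneq room => ->; rewrite -leqNgt near_full.
  rewrite in_relink (negbTE h2) /= orbF [m == u]eq_sym (negbTE um) /= vm eqxx /=.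
  by rewrite eq_sym.
have lt := near_partner iS nS e room um vm.
have nS' : near (relink S u v).
  move=> s t le; rewrite -nS //; apply: (relink_above wfS vS av (leq_trans lt le)).
    by move=> _; rewrite lu.
  by move=> _; rewrite lu.
case ez: (lmin S v) step => [z|] step; last first.
  exists (relink S u v); split; [exact: step| |by left; apply: near_top].
  by apply: eq_inv i2 => s; rewrite ez addn0.
have [|||| S' [loop iS' alt]] := IHn (relink S u v) z _ _ nS'.
- exact: leq_trans (ltn_sub2l (leq_trans lt_phi (phi_max _)) lt_phi) lt_n.
- by apply: eq_inv i2 => s; rewrite ez /mark [s == z]eq_sym.
- exact: room'.
- have dm : drops S u v m = mark m z by rewrite /drops lu ez.
  rewrite -dm (card_relink L) // 1?eq_sym //.
  by apply: leq_ltn_trans roomm; apply: leq_addr.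
by exists S'; split=> //; exact: step.
Qed.

Lemma blocked_first : exists S', [/\ affected_loop w b E S0 q None S' (Some m), inv (mark m) S'
    & top S' m q \/ agree S0 (rk m q) S' /\ low (rk m q) m].
Proof.
have i1 : inv (drops S0 q c) S1 := inv_bad wf0 qcP erefl nacc.
have step S' := @loop_step S0 q c None S' wf0 qcP; rewrite em in step.
have near1 : near S1 by [].
have room z : 0 < drops S0 q c z -> #|S1 z| < b z by apply: relink_room.
case ez: (lmin S0 c) step => [z|] step; last first.
  exists S1; split; [exact: step | | by left; apply: near_top].
  by apply: eq_inv i1 => s; rewrite /drops em ez addn0 /mark [s == m]eq_sym.
have [m0 _ _] := facts.
have cm : m != c by apply: contraTneq m0 => ->.
have qm : m != q by rewrite eq_sym (wf_neq sE wf0).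
have [|||S' [loop iS' alt]] := @blocked_loop S1 z _ near1.
- by apply: eq_inv i1 => s; rewrite /drops em ez /mark [s == m]eq_sym [s == z]eq_sym.
- by apply: room; rewrite /drops ez eqxx addn1.
- have := card_relink L0 qm cm; rewrite -/S1 /drops em ez eqxx => e1.
  apply: leq_trans (wf_size wf0 m); rewrite -e1 /mark.
  by rewrite addnCA add1n.
by exists S'; split=> //; exact: step.
Qed.

End Blocked.

Lemma find_affected_loop S x S' o Sf : affected_loop w b E S x None S' o ->
  find_affected_opt w b E S' o Sf -> find_affected w b E S x Sf.
Proof.
case: o => [y|] loop /=; first exact: FindAffectedLoose loop.
by move=> ->; apply: FindAffectedEnd.
Qed.

Lemma find_affected_opt_total S o :
  (forall y, o = Some y -> exists Sf, find_affected w b E S y Sf /\ stable E Sf) ->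
  inv (omark o) S -> exists Sf, find_affected_opt w b E S o Sf /\ stable E Sf.
Proof.
case: o => [y|] fa iS; first exact: fa.
by exists S; split=> //; apply/inv_stable; apply: eq_inv iS.
Qed.

(* A step can decrease phi only if it starts from S0 at a saturated vertex q; it
   then replaces the lightest edge of q.  Every later step of this kind replaces
   an edge of smaller rank. *)
Lemma find_affected_total K S x : inv (mark x) S -> agree S0 K S -> low K x ->
  exists Sf, find_affected w b E S x Sf /\ stable E Sf.
Proof.
(* Lexicographic induction: on [K], which drops at each exceptional step, then on the distance of
   [phi] to its upper bound. *)
have [k] := ubnP K; elim: k K S x => // k IHk K S x lt_k.
have [n] := ubnP (\sum_(p : V * V) 5 ^ rk p.1 p.2 - phi S).
elim: n S x => // n IHn S x lt_n iS ag lo; have wfS := proj1 iS.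
have mark_omark y T : inv (omark (Some y)) T -> inv (mark y) T.
  by apply: eq_inv => s; rewrite /mark eq_sym.
case e: (partner E S x) => [v|]; last first.
  exists S; split; first by apply: FindAffectedEnd; apply: AffectedNone.
  by apply/inv_stable; apply: inv_partner_None e; apply: eq_inv iS.
have [xvE vS av _] := partner_Some wfS e.
have [ax|nax] := boolP (acc S x v).
  have ag' := agree_relink stS0 wfS ag xvE vS ax av.
  have [S' [loop iS' agS' lt_phi lo']] := repair_first iS e ax ag'.
  have [|Sf [fa st]] := find_affected_opt_total _ iS'; last first.
    by exists Sf; split=> //; apply: find_affected_loop loop fa.
  move=> y ey; rewrite ey in iS'; apply: IHn => //; last exact: lo'.
    exact: leq_trans (ltn_sub2l (leq_trans lt_phi (phi_max _)) lt_phi) lt_n.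
  exact: mark_omark.
have SS0 : S = S0 := stable_uniq (repair_blocked_stable iS e nax) stS0.
rewrite SS0 in e nax wfS *.
have [m [em mS full _]] := bad_lmin wfS nax.
have lt_K : rk m x < K.
  rewrite ltnNge; apply/negP => le; move: lo; rewrite /low ltnNge => /negP; apply.
  rewrite -{1}full; apply: subset_leq_card; apply/subsetP=> y yS; rewrite inE yS /=.
  apply: leq_trans le _; rewrite rkC; move: em.
  case: (lminP (wf_size wfS x)) => // m' _ _ min [m'm].
  have [->//|ym] := eqVneq y m.
  by apply: ltnW; rewrite -m'm min // m'm.
have [S' [loop iS' alt]] := blocked_first e nax em.
have IH := IHk (rk m x) _ _ (leq_trans lt_K lt_k).
have iS1 : inv (omark (Some m)) S' by apply: eq_inv iS' => s; rewrite /mark eq_sym.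
have [|Sf [fa st]] := find_affected_opt_total _ iS1; last first.
  by exists Sf; split=> //; apply: find_affected_loop loop fa.
(* Either the loop has already retrieved the lost edge, or the first pass of the call on [m] does;
   both times the agreement reaches down to its rank. *)
move=> _ [<-]; case: alt => [tm|[ag' lo']]; last exact: IH.
have wfS' := proj1 iS'; have e' := top_partner wfS' tm.
have [S2 [loop2 iS2 ag2 _ lo2]] := repair_first iS' e' (top_acc tm) (agree_top wfS' tm).
have [|Sf [fa st]] := find_affected_opt_total _ iS2; last first.
  by exists Sf; split=> //; apply: find_affected_loop loop2 fa.
by move=> y ey; rewrite ey in iS2; apply: IH; [exact: mark_omark | | exact: lo2].
Qed.

(** The first vertex has room, so its call is a single loop without loose end. The second may have
    been saturated meanwhile, hence [find_affected_total]. *)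
Lemma repair_total S o1 o2 : inv (fun s => omark o1 s + omark o2 s) S ->
  (forall x, o1 = Some x -> #|S x| < b x) ->
  exists S1 Sf, [/\ find_affected_opt w b E S o1 S1, find_affected_opt w b E S1 o2 Sf
    & stable E Sf].
Proof.
(* No rank reaches this [K], so [agree] and [low] hold trivially at the start. *)
move=> iS room; pose K := #|{: V * V}|.+1.
have big s t : K <= rk s t -> False by rewrite leqNgt ltnS max_card.
have ag T : agree S0 K T by move=> s t /big.
have [S1 fa1 iS1] : exists2 S1, find_affected_opt w b E S o1 S1 & inv (omark o2) S1.
  case: o1 iS room => [x|] iS room; last by exists S.
  have [||S1 [loop i1 _ _]] := @loop_total (omark o2) K S x None _ _ (ag S).
  - by apply: eq_inv iS => s; rewrite addnC /mark eq_sym.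
  - exact: room.
  by exists S1 => //; apply: FindAffectedEnd.
have [|Sf [fa2 st]] := find_affected_opt_total _ iS1; last by exists S1, Sf; split.
move=> y ey; apply: (@find_affected_total K) => //.
  by rewrite ey in iS1; apply: eq_inv iS1 => s; rewrite /mark eq_sym.
rewrite /low (_ : [set v in S0 y | _] = set0) ?cards0 ?b_gt0 //.
by apply/setP=> v; rewrite !inE; apply/negbTE/andP => -[_ /big].
Qed.

End Repair.

(** * Determinism of the update procedures *)

Lemma affected_loop_det E S u l S1 l1 S2 l2 : affected_loop w b E S u l S1 l1 ->
  affected_loop w b E S u l S2 l2 -> S1 = S2 /\ l1 = l2.
Proof.
move=> A1; elim: A1 S2 l2 => {S u l S1 l1}.
- by move=> S u l e S2 l2 A2; inversion A2; subst; split; congruence.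
- by move=> S u l v l' S' e es S2 l2 A2; inversion A2; subst; split; congruence.
move=> S u l v x l' S' lf Sf e es _ IH S2 l2 A2; inversion A2; subst; try congruence.
by apply: IH; congruence.
Qed.

Lemma find_affected_det E S x S1 S2 : find_affected w b E S x S1 ->
  find_affected w b E S x S2 -> S1 = S2.
Proof.
move=> A1; elim: A1 S2 => {S x S1}.
  move=> S x S1 L1 S2 A2; inversion A2; subst.
    by have [] := affected_loop_det L1 H.
  by have [] := affected_loop_det L1 H.
move=> S x S1 y Sf L1 _ IH S2 A2; inversion A2; subst.
  by have [] := affected_loop_det L1 H.
have [e1 [e2]] := affected_loop_det L1 H; apply: IH; congruence.
Qed.

Lemma find_affected_opt_det E S o S1 S2 : find_affected_opt w b E S o S1 ->
  find_affected_opt w b E S o S2 -> S1 = S2.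
Proof. by case: o => [x|] /=; [exact: find_affected_det | move=> -> ->]. Qed.

Lemma edge_insertion_det E u v S S1 S2 : edge_insertion w b E u v S S1 ->
  edge_insertion w b E u v S S2 -> S1 = S2.
Proof.
rewrite /edge_insertion; case: ifP => _; last by move=> -> ->.
case: insert => o T; case: insert => o' T' [T1 a1 b1] [T2 a2 b2].
by rewrite (find_affected_opt_det a1 a2) in b1; apply: find_affected_opt_det b1 b2.
Qed.

Lemma edge_removal_det E u v S S1 S2 : edge_removal w b E u v S S1 ->
  edge_removal w b E u v S S2 -> S1 = S2.
Proof.
rewrite /edge_removal; case: ifP => _; last by move=> -> ->.
move=> [T1 a1 b1] [T2 a2 b2].
by rewrite (find_affected_det a1 a2) in b1; apply: find_affected_det b1 b2.
Qed.

Lemma dyn_bsuitor_det k E B S S1 S2 : dyn_bsuitor w b k E B S S1 ->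
  dyn_bsuitor w b k E B S S2 -> S1 = S2.
Proof.
move=> A1; elim: A1 S2 => {E B S S1}.
  by move=> E S S2 A2; inversion A2.
move=> E u v B S S' Sf up _ IH S2 A2; inversion A2; subst; apply: IH.
suff -> : S' = S'0 by [].
by case: k up H5 {H6 A2} => /=; [exact: edge_insertion_det | exact: edge_removal_det].
Qed.

(** * Edge updates *)

Lemma wf_sub_edges E E' S : E \subset E' -> wf E S -> wf E' S.
Proof. by move=> /subsetP EE' [h1 h2 h3]; split=> // u v /h2 /EE'. Qed.

Lemma relink_acc E S u v s t : linkable E S u v -> acc S u v -> acc S v u ->
  cnt (relink S u v s) s t + drops S u v s < b s ->
  [/\ acc S s t, s = u -> lmin S u != Some t & s = v -> lmin S v != Some t].
Proof.
move=> L au av; have wfS := lk_wf L; have vS := lk_new L.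
have uS : u \notin S v by rewrite -(wf_sym wfS).
have uv := edge_neq (lk_simple L) (lk_edge L).
have acc_le x y n : acc S x y = true -> cnt (S x) x t + n <= cnt (put S x y) x t ->
    cnt (put S x y) x t < b x -> acc S x t.
  by move=> _ le; apply: leq_ltn_trans; apply: leq_trans le; apply: leq_addr.
have [->|su] := eqVneq s u.
  rewrite (drops_uv L) ?eqxx // addn0 (relink_l L) => lt.
  have [le ne] := cnt_put (wf_size wfS u) vS au lt; split=> //; first exact: acc_le au le lt.
  by move/eqP; rewrite (negbTE uv).
have [->|sv] := eqVneq s v.
  rewrite (drops_uv L) ?eqxx ?orbT // addn0 (relink_r L) => lt.
  have [le ne] := cnt_put (wf_size wfS v) uS av lt; split=> //; first exact: acc_le av le lt.
  by move/eqP; rewrite eq_sym (negbTE uv).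
move=> lt; split; [|by move/eqP; rewrite (negbTE su)|by move/eqP; rewrite (negbTE sv)].
exact: leq_ltn_trans (cnt_relink _ _ su sv) lt.
Qed.

(** If one end rejects the new edge, it does not block and the lists stay stable. Otherwise the
    displaced vertices have the only vacancies, and with these discounted no edge blocks. *)
Lemma edge_insertion_total E u v S S0 (E' := E :|: [set [set u; v]]) :
  simple_graph E' -> [set u; v] \notin E -> stable E S -> stable E' S0 ->
  exists Sf, edge_insertion w b E' u v S Sf /\ stable E' Sf.
Proof.
move=> sE' uvE [wfS bl] st0.
have wfS' : wf E' S by apply: wf_sub_edges wfS; apply: subsetUl.
have uvE' : [set u; v] \in E' by rewrite !inE eqxx orbT.
have vS : v \notin S u by apply: contra uvE => /(wf_sub wfS).
have uS : u \notin S v by rewrite -(wf_sym wfS).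
have L : linkable E' S u v by [].
rewrite /edge_insertion -/(accepts S u v) -/(accepts S v u) !(wf_accepts wfS') //.
have [cnd|/negbTE nacc] := boolP (acc S u v && acc S v u); rewrite ?cnd ?nacc; last first.
  exists S; split=> //; split=> // s t; rewrite !inE => /orP[|/eqP es].
    exact: bl.
  have : s \in [set u; v] by rewrite -es set21.
  have ne := edge_neq sE' uvE'.
  move: nacc; rewrite !inE => nacc /orP[]/eqP e; rewrite e in es *.
    by rewrite (set2_injr es) => _ a1 a2; rewrite a1 a2 in nacc.
  by rewrite (set2_injr (etrans es (setUC _ _))) => _ a1 a2; rewrite a1 a2 in nacc.
have /andP[au av] := cnd; have [e1 e2 e3] := relinkE L; rewrite e1 /= e2 /= e3.
have iS : inv E' S0 (fun s => omark (lmin S u) s + omark (lmin S v) s) (relink S u v).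
  have wf4 := wf_relink L; split=> // s t stE tS a1 a2; exfalso.
  have [b1 n1 n2] := relink_acc L au av a1; have [b2 m1 m2] := relink_acc L au av a2.
  have x1 : ~~ ((s == u) && (t == v)) by apply: contra tS => h; rewrite in_relink h.
  have x2 : ~~ ((s == v) && (t == u)) by apply: contra tS => h; rewrite in_relink h orbT.
  have ndr : ~~ dropped S u v s t.
    by apply/negP=> /or4P[] /andP[/eqP e]; apply/negP; auto.
  apply: (bl s t) => //; last by apply: contra tS => h; rewrite in_relink h ndr !orbT.
  move: stE; rewrite !inE => /orP[//|/eqP es].
  have : s \in [set u; v] by rewrite -es set21.
  rewrite !inE => /orP[]/eqP e; rewrite e in es.
    by move: x1; rewrite e (set2_injr es) !eqxx.
  by move: x2; rewrite e (set2_injr (etrans es (setUC _ _))) !eqxx.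
have [|S5 [Sf [fa1 fa2 st]]] := repair_total sE' st0 iS; last first.
  by exists Sf; split=> //; exists S5.
by move=> x ex; apply: (relink_room L); rewrite /drops ex eqxx.
Qed.

Lemma edge_removal_total E u v S S0 (E' := E :\: [set [set u; v]]) :
  simple_graph E -> stable E S -> stable E' S0 ->
  exists Sf, edge_removal w b E' u v S Sf /\ stable E' Sf.
Proof.
move=> sE [wfS bl] st0; rewrite /edge_removal.
have sE' : simple_graph E' by move=> e; rewrite inE => /andP[_ /sE].
have [cnd|/negbTE nS] := boolP ((u \in S v) && (v \in S u)); rewrite ?cnd ?nS; last first.
  exists S; split=> //; split.
    case: wfS => h1 h2 h3; split=> // s t ts; rewrite !inE h2 // andbT.
    apply/negP => /eqP es; have : s \in [set u; v] by rewrite -es set21.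
    rewrite !inE => /orP[]/eqP e; rewrite e in es ts.
      by move: ts nS; rewrite (set2_injr es) -(h1 u v) => ->.
    by move: ts nS; rewrite (set2_injr (etrans es (setUC _ _))) (h1 u v) => ->.
  by move=> s t; rewrite !inE => /andP[_]; apply: bl.
have /andP[uS vS] := cnd; have uv : u != v := wf_neq sE wfS vS.
set S2 := remove _ v u.
have S2u : S2 u = S u :\ v by rewrite !ffunE (negbTE uv) eqxx.
have S2v : S2 v = S v :\ u by rewrite !ffunE eqxx eq_sym (negbTE uv).
have S2s s : s != u -> s != v -> S2 s = S s.
  by move=> su sv; rewrite !ffunE (negbTE su) (negbTE sv).
have in_S2 s t : (t \in S2 s) = (t \in S s) && ([set s; t] != [set u; v]).
  have [->|su] := eqVneq s u.
    by rewrite S2u !inE andbC; congr (_ && ~~ _); apply/eqP/eqP => [->//|/set2_injr].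
  have [->|sv] := eqVneq s v.
    rewrite S2v !inE andbC (setUC [set u]); congr (_ && ~~ _).
    by apply/eqP/eqP => [->//|/set2_injr].
  rewrite S2s //; case: (_ \in _) => //=; apply/esym/eqP => es.
  have : s \in [set u; v] by rewrite -es set21.
  by rewrite !inE (negbTE su) (negbTE sv).
have iS : inv E' S0 (fun s => omark (Some u) s + omark (Some v) s) S2.
  split.
    split=> [s t|s t|s].
    - by rewrite !in_S2 (wf_sym wfS) (setUC [set s]).
    - by rewrite in_S2 !inE => /andP[/(wf_sub wfS) -> ->].
    by apply: leq_trans (wf_size wfS s); apply: subset_leq_card; apply/subsetP=> t;
       rewrite in_S2 => /andP[].
  (* Each end of the removed edge lost one entry, which its discount makes up for. *)
  have acc2 s t : cnt (S2 s) s t + (omark (Some u) s + omark (Some v) s) < b s -> acc S s t.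
    apply: leq_ltn_trans; have D y x : cnt (S y) y t <= cnt (S y :\ x) y t + 1.
      by apply: leq_trans (cntD1 _ _ _ x) _; rewrite leq_add2l; case: (_ \in _).
    have [->|su] := eqVneq s u.
      by rewrite S2u; apply: leq_trans (D u v) _; rewrite leq_add2l /omark eqxx leq_addr.
    have [->|sv] := eqVneq s v; last by rewrite S2s // leq_addr.
    by rewrite S2v; apply: leq_trans (D v u) _; rewrite leq_add2l /omark eqxx leq_addl.
  move=> s t; rewrite in_S2 !inE => /andP[ne stE]; rewrite ne andbT => tS a1 a2.
  by have := bl s t stE tS (acc2 _ _ a1) (acc2 _ _ a2).
have [|S3 [Sf [fa1 fa2 st]]] := repair_total sE' st0 iS; last first.
  by exists Sf; split=> //; exists S3.
move=> _ [<-]; apply: leq_trans (wf_size wfS u); rewrite S2u.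
by rewrite [X in _ < X](cardsD1 v) vS.
Qed.

Lemma update_edges0 k E : update_edges k E set0 = E.
Proof. by case: k; rewrite /= ?setU0 ?setD0. Qed.

Lemma update_edgesU k E (A B : {set {set V}}) :
  update_edges k (update_edges k E A) B = update_edges k E (A :|: B).
Proof. by case: k; rewrite /= ?setUA ?setDDl. Qed.

Lemma dyn_bsuitor_total k E B S :
  (forall E', simple_graph E' -> exists S', stable E' S') ->
  simple_graph E -> simple_graph (updated_graph k E B) -> valid_batch k E B -> stable E S ->
  exists Sf, dyn_bsuitor w b k E B S Sf /\ stable (updated_graph k E B) Sf.
Proof.
move=> ex; elim: B E S => [|[u v] B IH] E S sE sEt val st.
  exists S; split; first exact: DynDone.
  rewrite /updated_graph /= (_ : [set:: [::]] = set0); first by rewrite update_edges0.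
  by apply/setP=> e; rewrite !inE.
pose E1 := update_edges k E [set [set u; v]].
have Et : updated_graph k E ((u, v) :: B) = updated_graph k E1 B.
  rewrite /updated_graph /E1 update_edgesU; congr update_edges.
  by apply/setP=> e; rewrite !inE.
rewrite Et in sEt *.
have sE1 : simple_graph E1.
  move: sEt; rewrite /updated_graph /E1; case: (k) => /= sEt e.
    by move=> eE; apply: sEt; rewrite inE eE.
  by rewrite inE => /andP[_ /sE].
have val1 : valid_batch k E1 B.
  case: val => /= /andP[nuv uB]; rewrite /E1 /valid_batch; case: (k) => /= h; split=> //.
    apply/pred0P => e /=; apply/negP => /andP[]; rewrite !inE => eB /orP[eE|/eqP ee].
      by have /pred0P/(_ e) := h; rewrite /= !inE eB orbT eE.
    by rewrite -ee eB in nuv.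
  apply/subsetP=> e; rewrite !inE => eB; rewrite (subsetP h) ?inE ?eB ?orbT // andbT.
  by apply: contra nuv => /eqP <-.
have [S0 st0] := ex _ sE1.
have [S1 [up st1]] : exists S1, edge_update w b k E1 u v S S1 /\ stable E1 S1.
  move: sE1 st0; rewrite /E1; case: (k) val => /= [[_ dis] sE1 st0|_ _ st0].
    apply: (@edge_insertion_total E u v S S0 sE1 _ st st0).
    by have /pred0P/(_ [set u; v]) := dis; rewrite /= !inE eqxx /= => ->.
  exact: (@edge_removal_total E u v S S0 sE st st0).
have [Sf [dyn stf]] := IH E1 S1 sE1 sEt val1 st1.
by exists Sf; split=> //; apply: DynStep up dyn.
Qed.

(** * The static algorithm *)

Definition proposals S u : {set V} := [set v | u \in S v].

(** The clause [si_best] records that proposals go out in decreasing order while thresholds only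
    rise: as long as some [t] would still take [u], no copy of [u] has been discarded and its
    standing proposals are at heavier neighbors. *)
Record static_inv E (Q : seq V) S : Prop := StaticInv {
  si_sub : forall u v, v \in S u -> [set u; v] \in E;
  si_size : forall u, #|S u| <= b u;
  si_count : forall u, #|proposals S u| + count_mem u Q <= b u;
  si_best : forall u t, [set u; t] \in E -> u \notin S t -> acc S t u ->
    #|proposals S u| + count_mem u Q = b u /\ forall v, u \in S v -> rk u t < rk u v }.

Lemma si_accepts E Q S u v : static_inv E Q S -> u \notin S v -> accepts S v u = acc S v u.
Proof. by move=> si uS; rewrite acceptsE ?(si_size si). Qed.

Lemma static_step_inv E Q S u : static_inv E (u :: Q) S ->
  static_inv E (bsuitor_step w b E u Q S).1 (bsuitor_step w b E u Q S).2.
Proof.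
move=> si; rewrite /bsuitor_step; case e: (proposal w b E S u) => [p|]; last first.
  have none t : [set u; t] \in E -> u \notin S t -> acc S t u -> False.
    move=> utE uS at_; have /setP/(_ t) := argmax_None e; rewrite !inE utE uS.
    by rewrite (si_accepts si uS) at_.
  split=> [||v|v t vtE vS at_]; first exact: (si_sub si); first exact: si_size si.
    by apply: leq_trans (si_count si v); rewrite leq_add2l /= leq_addl.
  have vu : v != u by apply/eqP => vu; rewrite vu in vtE vS at_; exact: none vtE vS at_.
  have [<- h] := si_best si vtE vS at_; split=> //=.
  by rewrite eq_sym (negbTE vu).
have [] := argmax_Some e; rewrite !inE => /and3P[upE uS]; rewrite (si_accepts si uS) => ap max.
rewrite insertE /=; set S' := set_list _ _ _; set Q' := if _ is Some z then _ else _.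
have szp := si_size si p.
have S'p : S' p = put S p u by rewrite ffunE eqxx.
have S'v v : v != p -> S' v = S v by move=> vp; rewrite ffunE (negbTE vp).
(* Copies are conserved: the popped one becomes a proposal, and the proposal displaced at [p]
   returns to the queue. *)
have total x : #|proposals S' x| + count_mem x Q' = #|proposals S x| + count_mem x (u :: Q).
  have -> : count_mem x Q' = (lmin S p == Some x) + count_mem x Q.
    rewrite /Q'; case: (lmin S p) => [z|] //=.
    by rewrite -cats1 count_cat /= addn0 addnC.
  rewrite /= !addnA; congr (_ + _).
  rewrite (cardsD1 p) [in RHS](cardsD1 p) !inE.
  have -> : proposals S' x :\ p = proposals S x :\ p.
    by apply/setP=> v; rewrite !inE; case: eqP => //= /eqP vp; rewrite S'v.
  rewrite addnAC [RHS]addnAC; congr (_ + _); rewrite S'p /put inE inE.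
  case: (lminP szp) => [_|m _ mS _] /=.
    by have [->|_] := eqVneq x u; rewrite ?eqxx ?(negbTE uS) ?addn0.
  rewrite !inE (_ : (Some m == Some x) = (m == x)) //.
  have mu : m != u by apply: contraNneq uS => <-.
  have [->|xu] := eqVneq x u; first by rewrite (negbTE mu) (negbTE uS).
  rewrite addn0 [m == x]eq_sym.
  by have [->|_] := eqVneq x m; rewrite ?mS ?addn0.
have old x t : x \notin S' t -> acc S' t x -> x \notin S t /\ acc S t x.
  have [->|tp] := eqVneq t p; last by rewrite /acc S'v.
  by rewrite /acc S'p => xS lt; exact: (acc_put szp uS ap xS lt).
split=> [x v|x|x|x t xtE xS at_].
- have [->|xp] := eqVneq x p; last by rewrite S'v //; apply: (si_sub si).
  rewrite S'p !inE => /orP[/eqP->|/(subsetP (del_sub _ _))]; last exact: (si_sub si).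
  by rewrite setUC.
- have [->|xp] := eqVneq x p; last by rewrite S'v // (si_size si).
  by rewrite S'p card_put // geq_minl.
- by rewrite total (si_count si).
have [xSt at'] := old x t xS at_; have [eb best] := si_best si xtE xSt at'.
rewrite total; split=> // v; have [->|vp] := eqVneq v p; last by rewrite S'v //; apply: best.
rewrite S'p !inE => /orP[/eqP xu|/(subsetP (del_sub _ _))]; last exact: best.
rewrite xu in xtE xS xSt at' *; apply: max.
  by rewrite !inE xtE xSt (si_accepts si xSt).
by apply: contraNneq xS => ->; rewrite S'p !inE eqxx.
Qed.

Lemma bsuitor_loop_total E Q S : static_inv E Q S ->
  exists Sf, bsuitor_loop w b E Q S Sf /\ static_inv E [::] Sf.
Proof.
(* A proposal closes the pair [(u, p)] and opens none, while the queue, having lost [u], regains at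
   most one entry; without proposal the queue shortens. *)
pose open (T : @lists d V) :=
  [set p : V * V | [&& [set p.1; p.2] \in E, p.1 \notin T p.2 & acc T p.2 p.1]].
have [n] := ubnP (#|open S| + size Q); elim: n Q S => // n IHn [|u Q] S lt_n si.
  by exists S; split=> //; constructor.
have si' := static_step_inv si.
have [|Sf [loop sif]] := IHn _ _ _ si'; last by exists Sf; split=> //; constructor.
move: si'; rewrite /bsuitor_step; case e: (proposal w b E S u) => [p|] /= si'; last first.
  by rewrite addnS in lt_n.
have [] := argmax_Some e; rewrite !inE => /and3P[upE uS]; rewrite (si_accepts si uS) => ap _.
rewrite insertE /=; set S' := set_list _ _ _; set Q' := if _ is Some z then _ else _.
have le_Q : size Q' <= (size Q).+1.
  by rewrite /Q'; case: (lmin S p) => [z|]; rewrite ?size_rcons.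
have szp := si_size si p.
have S'p : S' p = put S p u by rewrite ffunE eqxx.
have lt_open : #|open S'| < #|open S|.
  apply: proper_card; apply/properP; split; last first.
    by exists (u, p); rewrite !inE /= ?upE ?uS ?S'p ?inE ?eqxx.
  apply/subsetP=> -[x t]; rewrite !inE /= => /and3P[->]; have [->|tp] := eqVneq t p; last first.
    by rewrite /acc ffunE (negbTE tp) => -> ->.
  rewrite /acc S'p => xS lt; have [xSp ax] := acc_put szp uS ap xS lt.
  by rewrite xSp ax.
apply: leq_trans (_ : _ <= #|open S| + (size Q).+1) lt_n.
by rewrite -addSn leq_add.
Qed.

Lemma bsuitor_loop_det E Q S S1 S2 : bsuitor_loop w b E Q S S1 ->
  bsuitor_loop w b E Q S S2 -> S1 = S2.
Proof.
move=> A1; elim: A1 S2 => {Q S S1} [S|u Q S Sf _ IH] S2 A2; inversion A2; subst => //.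
exact: IH.
Qed.

(** For symmetry, let [u] be in the list of [v] but not conversely. If [u] would accept [v], then
    [v] has [b v] proposals at heavier neighbors, which by induction lie in its list besides [u].
    Otherwise the [b u] heavier entries of [u] hold its proposals by induction, and the proposal to
    [v] is one too many. *)
Lemma static_inv_stable E S : static_inv E [::] S -> stable E S.
Proof.
move=> si; have sz := si_size si.
have le_prop u : #|proposals S u| <= b u by have := si_count si u; rewrite addn0.
have sym u v : u \in S v -> v \in S u.
  move: u v; apply: rk_ind => u v IH uS; apply/negPn/negP => vS.
  have vuE := si_sub si uS.
  have [av|nav] := boolP (acc S u v).
    have [eb best] := si_best si vuE vS av; rewrite addn0 in eb.
    have: #|proposals S v| < #|S v|; last by rewrite eb ltnNge sz.
    apply: proper_card; apply/properP; split.
      by apply/subsetP=> x; rewrite inE => vx; apply: IH => //; rewrite (rkC u) best.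
    by exists u; rewrite // inE.
  move: nav; rewrite /acc -leqNgt => full.
  have: b u < #|proposals S u|; last by rewrite ltnNge le_prop.
  apply: leq_ltn_trans full _; apply: proper_card; apply/properP; split.
    by apply/subsetP=> x; rewrite !inE => /andP[xS lt]; apply: IH; rewrite // (rkC x).
  by exists v; rewrite !inE // (negbTE vS).
have propE u : proposals S u = S u.
  by apply/setP=> v; rewrite inE; apply/idP/idP; apply: sym.
split=> [|u v uvE vS au av].
  by split=> // [u v|]; [apply/idP/idP; apply: sym | exact: (si_sub si)].
have uS : u \notin S v by apply: contra vS; apply: sym.
(* As [v] would take [u], all [b u] partners of [u] are heavier than [v], so [u] rejects [v]. *)
have [eb best] := si_best si uvE uS av; rewrite addn0 propE in eb.
move: au; rewrite /acc cnt_all ?eb ?ltnn // => x xS.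
exact/best/sym.
Qed.

Lemma static_inv0 E Q : initial_queue b Q -> static_inv E Q (empty_lists).
Proof.
move=> iQ; have prop0 u : proposals empty_lists u = set0.
  by apply/setP=> v; rewrite !inE ffunE inE.
split=> [u v|u|u|u t _ _ _].
- by rewrite ffunE inE.
- by rewrite ffunE cards0.
- by rewrite prop0 cards0 iQ.
by rewrite prop0 cards0 iQ; split=> // v; rewrite ffunE inE.
Qed.

Lemma bsuitor_total E Q : initial_queue b Q -> exists S, bsuitor w b E Q S.
Proof.
by move=> /(static_inv0 E) /bsuitor_loop_total[Sf [loop _]]; exists Sf.
Qed.

Lemma bsuitor_stable E Q S : initial_queue b Q -> bsuitor w b E Q S -> stable E S.
Proof.
move=> /(static_inv0 E) /bsuitor_loop_total[Sf [loop si]] loop'.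
by rewrite (bsuitor_loop_det loop' loop); apply: static_inv_stable.
Qed.

(** * Approximation *)

Lemma rk_weight u v x : rk u v < rk u x -> (w [set u; v] <= w [set u; x])%R.
Proof.
by rewrite -heavierE /heavier => /orP[/ltW//|/andP[/eqP-> _]].
Qed.

Section HalfApproximation.
Variables (E : {set {set V}}) (S : @lists d V).
Hypotheses (sE : simple_graph E) (stS : stable E S).
Hypothesis w_gt0 : forall e, e \in E -> (0 < w e)%R.

Let wfS : wf E S := proj1 stS.
Let M := matching_of E S.

Lemma in_matching u v : ([set u; v] \in M) = (v \in S u).
Proof.
apply/imsetP/idP => [[[x y]] /=|vS].
  rewrite inE /= => /and3P[_ yS xS] es; have : u \in [set x; y] by rewrite -es set21.
  rewrite !inE => /orP[]/eqP e; rewrite e in es *.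
    by rewrite (set2_injr es).
  by rewrite (set2_injr (etrans es (setUC _ _))).
by exists (u, v); rewrite // inE /= (wf_sub wfS vS) vS -(wf_sym wfS).
Qed.

Lemma matching_edges : M \subset E.
Proof. by apply/subsetP=> _ /imsetP[p + ->]; rewrite inE => /and3P[]. Qed.

Lemma edge_ends e u : e \in E -> u \in e -> exists v, e = [set u; v].
Proof.
move=> /sE/eqP/cards2P[x [y [_ ->]]]; rewrite !inE => /orP[]/eqP->; first by exists y.
by exists x; rewrite setUC.
Qed.

Lemma matching_at u : [set e in M | u \in e] = [set [set u; v] | v in S u].
Proof.
apply/setP=> e; rewrite inE; apply/andP/imsetP => [[eM ue]|[v vS ->]].
  have [v ev] := edge_ends (subsetP matching_edges _ eM) ue.
  by exists v => //; rewrite -in_matching -ev.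
by rewrite in_matching vS set21.
Qed.

Lemma card_matching_at u : #|[set e in M | u \in e]| = #|S u|.
Proof. by rewrite matching_at card_imset // => x y /set2_injr. Qed.

Lemma matching_bmatching : bmatching b E M.
Proof. by split=> [|u]; rewrite ?matching_edges // card_matching_at (wf_size wfS). Qed.

(** Both sums are compared with multiples of the largest value of [f] on [C]. *)
Lemma sum_dominated (T : finType) (f : T -> R) (C D : {set T}) :
  #|C| <= #|D| -> (forall c e, c \in C -> e \in D -> (f c <= f e)%R) ->
  (forall c, c \in C -> (0 <= f c)%R) -> (forall e, e \in D -> (0 <= f e)%R) ->
  (\sum_(c in C) f c <= \sum_(e in D) f e)%R.
Proof.
move=> leCD fCD fC fD; have [->|[c0 c0C]] := set_0Vmem C.
  by rewrite big_set0; apply: sumr_ge0.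
case: (arg_maxP f c0C) => c cC cmax.
apply: (@le_trans _ _ (f c *+ #|C|)%R).
  by rewrite -sumr_const; apply: ler_sum => x /cmax.
apply: (@le_trans _ _ (f c *+ #|D|)%R).
  by apply: ler_wpMn2l => //; apply: fC.
by rewrite -sumr_const; apply: ler_sum => x xD; apply: fCD.
Qed.

(* Each edge of M' outside M is charged to an endpoint that prefers all its
   partners in M to that edge. *)
Lemma stable_half (M' : {set {set V}}) : bmatching b E M' ->
  (weight w M' <= weight w M *+ 2)%R.
Proof.
move=> [/subsetP M'E M'b]; have ME := subsetP matching_edges.
pose C u := [set e in M' :\: M | [exists v, (e == [set u; v]) && ~~ acc S u v]].
pose D u := [set e in M :\: M' | u \in e].
have CE u c : c \in C u -> c \in E by rewrite !inE => /andP[/andP[_ /M'E]].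
have CD u : (\sum_(e in C u) w e <= \sum_(e in D u) w e)%R.
  apply: sum_dominated.
  - have [->|[c0]] := set_0Vmem (C u); first by rewrite cards0.
    rewrite inE => /andP[_ /existsP[v0 /andP[_ nacc]]].
    have full : #|S u| = b u.
      apply/eqP; rewrite eqn_leq (wf_size wfS) /=; move: nacc; rewrite /acc -leqNgt => full.
      exact: leq_trans full (cnt_le _ _ _).
    pose I := [set e in M :&: M' | u \in e].
    (* With the common edges at [u] added, [M'] contributes at most [b u], and [M] has exactly [b u]
       there since a rejecting vertex is full. *)
    rewrite -(leq_add2r #|I|); apply: (@leq_trans (b u)).
      apply: leq_trans (M'b u); rewrite -cardsUI (_ : C u :&: I = set0) ?cards0 ?addn0.
        apply: subset_leq_card; apply/subsetP=> e; rewrite !inE => /orP[].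
          by case/andP=> /andP[_ ->] /existsP[v /andP[/eqP-> _]]; rewrite set21.
        by case/andP=> /andP[_ ->].
      by apply/setP=> e; rewrite !inE; case: (e \in M); rewrite ?andbF.
    rewrite -full -card_matching_at -cardsUI addnC; apply: leq_trans (leq_addl _ _).
    by apply: subset_leq_card; apply/subsetP=> e; rewrite !inE => /andP[-> ->];
       rewrite !andbT; case: (e \in M').
  - move=> c e; rewrite inE => /andP[_ /existsP[v /andP[/eqP-> nacc]]].
    rewrite inE => /andP[/setDP[eM _] ue].
    have [x ex] := edge_ends (ME _ eM) ue; rewrite ex in eM *.
    apply: rk_weight; move: nacc; rewrite /acc -leqNgt => /cnt_geP; apply.
      exact: wf_size wfS u.
    by rewrite -in_matching.
  - by move=> c /CE /w_gt0 /ltW.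
  by move=> e; rewrite inE => /andP[/setDP[/ME /w_gt0 /ltW]].
have charge : (\sum_(e in M' :\: M) w e <= \sum_u \sum_(e in C u) w e)%R.
  rewrite (exchange_big_dep (fun e => e \in M' :\: M)) /=; last first.
    by move=> u e _; rewrite inE => /andP[].
  apply: ler_sum => e eM; have eE : e \in E by apply: M'E; case/setDP: eM.
  have [u [eu]] : exists u, e \in C u.
    have /eqP/cards2P[x [y [_ exy]]] := sE eE.
    have [ax|nax] := boolP (acc S x y); last first.
      by exists x; rewrite inE eM; apply/existsP; exists y; rewrite exy eqxx.
    exists y; rewrite inE eM; apply/existsP; exists x; rewrite exy setUC eqxx /=.
    apply/negP => ay; apply: (proj2 stS x y) ax ay; first by rewrite -exy.
    by rewrite -in_matching -exy; case/setDP: eM.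
  rewrite (bigD1 u) //= lerDl; apply: sumr_ge0 => _ _; exact/ltW/w_gt0.
(* Each edge of [M] outside [M'] is used at both of its endpoints, whence the factor 2. *)
have count2 : (\sum_u \sum_(e in D u) w e = (\sum_(e in M :\: M') w e) *+ 2)%R.
  rewrite (exchange_big_dep (fun e => e \in M :\: M')) /=; last first.
    by move=> u e _; rewrite inE => /andP[].
  rewrite -sumrMnl; apply: eq_bigr => e eM; rewrite sumr_const; congr (_ *+ _)%R.
  rewrite -(sE (ME _ (subsetP (subsetDl _ _) _ eM))).
  by apply: eq_card => u; rewrite unfold_in /= -[LHS]/(e \in D u) !inE; case/setDP: eM => -> ->.
have ge0 (F : {set {set V}}) : F \subset E -> (0 <= \sum_(e in F) w e)%R.
  by move=> /subsetP AE; apply: sumr_ge0 => e /AE/w_gt0/ltW.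
rewrite /weight (big_setID M) [X in (_ <= X *+ 2)%R](big_setID M') /= mulrnDl.
apply: lerD; last by rewrite -count2; apply: le_trans charge _; apply: ler_sum => u _.
by rewrite setIC mulr2n lerDl ge0 // (subset_trans (subsetIl _ _)) // matching_edges.
Qed.

Lemma stable_half_approximation : half_approximation w b E M.
Proof.
split=> [|M' [bM' _]]; first exact: matching_bmatching.
by rewrite ler_pdivrMr ?ltr0n // mulr_natr; apply: stable_half.
Qed.

End HalfApproximation.

End BSuitor.

Theorem theorem1 (d : Order.disp_t) (V : finOrderType d) (R : realFieldType)
    (w : {set V} -> R) (b : V -> nat) (E : {set {set V}})
    (k : batch_kind) (B : seq (V * V)) (Q Qt : seq V) :
  let Et := updated_graph k E B in
  simple_graph E -> simple_graph Et ->
  (forall e, e \in E :|: Et -> (0 < w e)%R) ->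
  (forall v, 1 <= b v) ->
  valid_batch k E B ->
  initial_queue b Q -> initial_queue b Qt ->
  (exists S, bsuitor w b E Q S) /\
  (exists St, bsuitor w b Et Qt St) /\
  forall S St : lists, bsuitor w b E Q S -> bsuitor w b Et Qt St ->
    (exists Sf, dyn_bsuitor w b k E B S Sf) /\
    half_approximation w b Et (matching_of Et St) /\
    forall Sf, dyn_bsuitor w b k E B S Sf ->
      matching_of Et Sf = matching_of Et St.
Proof.
move=> Et sE sEt w_gt0 b_gt0 val iQ iQt.
split; first exact: bsuitor_total iQ.
split; first exact: bsuitor_total iQt.
move=> S St bS bSt.
have stS := bsuitor_stable b_gt0 iQ bS; have stSt := bsuitor_stable b_gt0 iQt bSt.
(* The multiplicities in [Q] depend on [b] alone, so b-suitor with this queue yields stable lists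
   for every intermediate graph. *)
have ex E' : simple_graph E' -> exists S', stable w b E' S'.
  move=> _; have [S' bS'] := bsuitor_total w b_gt0 E' iQ.
  by exists S'; exact: (bsuitor_stable b_gt0 iQ bS').
have [Sf [dyn stf]] := dyn_bsuitor_total b_gt0 ex sE sEt val stS.
split; first by exists Sf.
split.
  by apply: stable_half_approximation => // e eE; apply: w_gt0; rewrite inE eE orbT.
(* Every run coincides with the one found, whose final lists are stable and hence those of b-suitor
   on [Et]. *)
by move=> Sf' /dyn_bsuitor_det/(_ dyn) ->; rewrite (stable_uniq stf stSt).
Qed.
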